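(* Suppose that Assumption (A2) (see context) is satisfied with respect to a critical point $x^\star$, and let $\gamma\in(0,\min\{\Gamma(x^\star),1/L_f\})$. The following are equivalent: (a) $x^\star$ is a strong local minimum for $\varphi$; (b) $x^\star$ is a local minimum for $\varphi$ and $JR_\gamma(x^\star)$ is nonsingular; (c) the (symmetric) matrix $\nabla^2\varphi_\gamma(x^\star)$ is positive definite; (d) $x^\star$ is a strong local minimum for $\varphi_\gamma$; (e) $x^\star$ is a local minimum for $\varphi_\gamma$ and $JR_\gamma(x^\star)$ is nonsingular.
   Context: Standing assumptions: $f:\mathbb{R}^n\to\mathbb{R}$ is differentiable with Lipschitz continuous gradient, $L_f$ denoting the Lipschitz modulus of $\nabla f$ (with $1/L_f=+\infty$ if $L_f=0$); $g:\mathbb{R}^n\to\mathbb{R}\cup\{+\infty\}$ is proper, lower semicontinuous and prox-bounded, meaning that $g+\frac{1}{2\gamma}\|\cdot\|^2$ is bounded below for some $\gamma>0$; $\gamma_g\in(0,+\infty]$ is the supremum of all such $\gamma$; $\varphi:=f+g$ and $\operatorname{argmin}\varphi\neq\emptyset$. Neither function need be convex. For $\gamma>0$: $\operatorname{prox}_{\gamma g}(y):=\operatorname{argmin}_z\{g(z)+\frac{1}{2\gamma}\|z-y\|^2\}$; $T_\gamma(x):=\operatorname{prox}_{\gamma g}(x-\gamma\nabla f(x))$ and $R_\gamma(x):=\frac1\gamma(x-T_\gamma(x))$ (set-valued maps); $\varphi_\gamma(x):=\inf_{z}\{f(x)+\langle\nabla f(x),z-x\rangle+\frac{1}{2\gamma}\|z-x\|^2+g(z)\}$.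 Under (A2) and $\gamma<\Gamma(x^\star)$, $R_\gamma$ is single-valued around and differentiable at $x^\star$ with Jacobian $JR_\gamma(x^\star)$, and $\varphi_\gamma$ is twice differentiable at $x^\star$ (differentiable around $x^\star$ with gradient differentiable at $x^\star$) with symmetric Hessian $\nabla^2\varphi_\gamma(x^\star)$. A point $x^\star\in\operatorname{dom}\varphi$ is critical if $x^\star\in T_\gamma(x^\star)$ for some $\gamma\in(0,\gamma_g)$; $\Gamma(x):=\sup(\{\gamma>0:x\in T_\gamma(x)\}\cup\{0\})$. A strong local minimum $x^\star$ of a function $h$ is a point for which there are $c>0$ and a neighborhood $U$ of $x^\star$ with $h(x)\ge h(x^\star)+c\|x-x^\star\|^2$ for all $x\in U$. $\partial g$ is the limiting subdifferential: $v\in\partial g(x)$ iff there are $x^k\to x$ with $g(x^k)\to g(x)$ and $v^k\to v$ with $v^k$ a regular (Fréchet) subgradient of $g$ at $x^k$. $g$ is prox-regular at $x_0$ for $v_0\in\partial g(x_0)$ if there exist $\rho,\varepsilon>0$ such that $g(x')\ge g(x)+\langle v,x'-x\rangle-\frac\rho2\|x'-x\|^2$ for all $x'\in B(x_0;\varepsilon)$ and all $(x,v)$ with $v\in\partial g(x)$, $x\in B(x_0;\varepsilon)$, $v\in B(v_0;\varepsilon)$, $g(x)\le g(x_0)+\varepsilon$. For $v\in\partial g(x)$ and $\tau>0$ let $\Delta^2_\tau g(x|v)[d]:=\frac{g(x+\tau d)-g(x)-\tau\langle v,d\rangle}{\tau^2/2}$. $g$ is twice epi-differentiable at $x$ for $v$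 if $\Delta^2_\tau g(x|v)$ epi-converges as $\tau\searrow0$ to a proper function, denoted $\mathrm{d}^2g(x|v)[\cdot]$. Assumption (A2) with respect to a critical point $x^\star$: $\nabla^2f$ exists and is continuous around $x^\star$; $g$ is prox-regular and twice epi-differentiable at $x^\star$ for $-\nabla f(x^\star)$, with $\mathrm{d}^2g(x^\star|-\nabla f(x^\star))[d]=\langle d,Md\rangle+\delta_S(d)$ for all $d\in\mathbb{R}^n$, where $S\subseteq\mathbb{R}^n$ is a linear subspace, $\delta_S$ its indicator function ($0$ on $S$, $+\infty$ elsewhere), and $M\in\mathbb{R}^{n\times n}$; without loss of generality $M$ is symmetric with $\operatorname{Im}(M)\subseteq S$ and $\ker(M)\supseteq S^\perp$.
   Formalization: Single-valuedness of R_γ around x* is an added hypothesis: it does not follow from (A2) and γ<Γ(x* ) (e.g. f=0, x*=0, g'(x)=x/2+x² sin(1/x), γ=10), and without it JR_γ(x* ) and ∇²φ_γ(x* ) are undefined. *)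

(* Defs.v *)
From HB Require Import structures.
From mathcomp Require Import all_boot all_order all_algebra.
From mathcomp Require Import all_classical all_reals all_analysis.

Set Implicit Arguments.
Unset Strict Implicit.
Unset Printing Implicit Defensive.

Import Order.TTheory GRing.Theory Num.Theory.
Import numFieldNormedType.Exports.

Local Open Scope classical_set_scope.
Local Open Scope ring_scope.

(* The library norm on 'rV[R]_n is the sup norm; it induces the usual topology
   (and the usual notion of differentiability), but every metric quantity below
   is Euclidean. *)
Definition dotp (R : realType) (n : nat) (u v : 'rV[R]_n) : R :=
  (u *m v^T) 0 0.

Definition enorm (R : realType) (n : nat) (u : 'rV[R]_n) : R :=
  Num.sqrt (dotp u u).

Definition grad (R : realType) (n : nat) (f : 'rV[R]_n -> R) (x : 'rV[R]_n) :
    'rV[R]_n :=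
  \row_i 'd f x (delta_mx 0 i).

(* 'J acts on row vectors from the right, 'D_v F x = v *m 'J F x, so it is the
   transpose of the Jacobian acting on columns. *)
Definition hessian (R : realType) (n : nat) (f : 'rV[R]_n -> R)
    (x : 'rV[R]_n) : 'M[R]_n :=
  'J (grad f) x.

Definition lipschitz_const (R : realType) (n : nat)
    (F : 'rV[R]_n -> 'rV[R]_n) : set R :=
  [set L | 0 <= L /\ forall x y, enorm (F x - F y) <= L * enorm (x - y)].

Definition lipschitz_modulus (R : realType) (n : nat)
    (F : 'rV[R]_n -> 'rV[R]_n) : R :=
  inf (lipschitz_const F).

Definition posdef (R : realType) (n : nat) (A : 'M[R]_n) : Prop :=
  A^T = A /\ forall d : 'rV[R]_n, d != 0 -> 0 < dotp d (d *m A).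

Definition edom (R : realType) (n : nat) (h : 'rV[R]_n -> \bar R) :
    set 'rV[R]_n :=
  [set x | (h x < +oo)%E].

Definition proper_fun (R : realType) (n : nat) (h : 'rV[R]_n -> \bar R) : Prop :=
  (forall x, (-oo < h x)%E) /\ edom h !=set0.

Definition argmin (R : realType) (n : nat) (h : 'rV[R]_n -> \bar R) :
    set 'rV[R]_n :=
  [set x | forall y, (h x <= h y)%E].

Definition local_min (R : realType) (n : nat) (h : 'rV[R]_n -> \bar R)
    (x : 'rV[R]_n) : Prop :=
  \forall y \near x, (h x <= h y)%E.

Definition strong_local_min (R : realType) (n : nat) (h : 'rV[R]_n -> \bar R)
    (x : 'rV[R]_n) : Prop :=
  exists2 c : R, 0 < c &
    \forall y \near x, (h x + (c * enorm (y - x) ^+ 2)%:E <= h y)%E.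

Definition prox_bound_params (R : realType) (n : nat)
    (g : 'rV[R]_n -> \bar R) : set R :=
  [set gamma | 0 < gamma /\
    exists b : R, forall z, (b%:E <= g z + ((2 * gamma)^-1 * enorm z ^+ 2)%:E)%E].

Definition prox_bounded (R : realType) (n : nat) (g : 'rV[R]_n -> \bar R) :
    Prop :=
  prox_bound_params g !=set0.

Definition prox_threshold (R : realType) (n : nat) (g : 'rV[R]_n -> \bar R) :
    \bar R :=
  ereal_sup (EFin @` prox_bound_params g).

Definition prox (R : realType) (n : nat) (gamma : R) (g : 'rV[R]_n -> \bar R)
    (y : 'rV[R]_n) : set 'rV[R]_n :=
  argmin (fun z => (g z + ((2 * gamma)^-1 * enorm (z - y) ^+ 2)%:E)%E).

Definition fb_map (R : realType) (n : nat) (f : 'rV[R]_n -> R)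
    (g : 'rV[R]_n -> \bar R) (gamma : R) (x : 'rV[R]_n) : set 'rV[R]_n :=
  prox gamma g (x - gamma *: grad f x).

Definition fb_residual (R : realType) (n : nat) (f : 'rV[R]_n -> R)
    (g : 'rV[R]_n -> \bar R) (gamma : R) (x : 'rV[R]_n) : set 'rV[R]_n :=
  [set gamma^-1 *: (x - z) | z in fb_map f g gamma x].

Definition objective (R : realType) (n : nat) (f : 'rV[R]_n -> R)
    (g : 'rV[R]_n -> \bar R) (x : 'rV[R]_n) : \bar R :=
  ((f x)%:E + g x)%E.

Definition fb_envelope (R : realType) (n : nat) (f : 'rV[R]_n -> R)
    (g : 'rV[R]_n -> \bar R) (gamma : R) (x : 'rV[R]_n) : \bar R :=
  ereal_inf (range (fun z : 'rV[R]_n =>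
    ((f x + dotp (grad f x) (z - x)
      + (2 * gamma)^-1 * enorm (z - x) ^+ 2)%:E + g z)%E)).

Definition critical (R : realType) (n : nat) (f : 'rV[R]_n -> R)
    (g : 'rV[R]_n -> \bar R) (x : 'rV[R]_n) : Prop :=
  edom (objective f g) x /\
  exists gamma : R, [/\ 0 < gamma, (gamma%:E < prox_threshold g)%E &
                        fb_map f g gamma x x].

Definition critical_threshold (R : realType) (n : nat) (f : 'rV[R]_n -> R)
    (g : 'rV[R]_n -> \bar R) (x : 'rV[R]_n) : \bar R :=
  ereal_sup (EFin @` ([set gamma : R | 0 < gamma /\ fb_map f g gamma x x]
                      `|` [set 0])).

Definition regular_subdiff (R : realType) (n : nat) (g : 'rV[R]_n -> \bar R)
    (x : 'rV[R]_n) : set 'rV[R]_n :=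
  [set v | g x \is a fin_num /\
    forall e : R, 0 < e -> \forall z \near x,
      (g x + (dotp v (z - x) - e * enorm (z - x))%:E <= g z)%E].

Definition limiting_subdiff (R : realType) (n : nat) (g : 'rV[R]_n -> \bar R)
    (x : 'rV[R]_n) : set 'rV[R]_n :=
  [set v | g x \is a fin_num /\
    exists xs vs : nat -> 'rV[R]_n,
      [/\ xs @ \oo --> x, (g \o xs) @ \oo --> g x, vs @ \oo --> v &
          forall k, regular_subdiff g (xs k) (vs k)]].

Definition prox_regular (R : realType) (n : nat) (g : 'rV[R]_n -> \bar R)
    (x0 v0 : 'rV[R]_n) : Prop :=
  limiting_subdiff g x0 v0 /\
  exists rho eps : R, [/\ 0 < rho, 0 < eps &
    forall x' x v : 'rV[R]_n,
      enorm (x' - x0) < eps ->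
      limiting_subdiff g x v ->
      enorm (x - x0) < eps ->
      enorm (v - v0) < eps ->
      (g x <= g x0 + eps%:E)%E ->
      (g x + (dotp v (x' - x) - rho / 2 * enorm (x' - x) ^+ 2)%:E <= g x')%E].

Definition second_diff_quotient (R : realType) (n : nat)
    (g : 'rV[R]_n -> \bar R) (x v : 'rV[R]_n) (tau : R) (d : 'rV[R]_n) :
    \bar R :=
  ((g (x + tau *: d)%R - g x - (tau * dotp v d)%:E) / (tau ^+ 2 / 2)%:E)%E.

Definition epi_cvg_seq (R : realType) (n : nat)
    (h : nat -> 'rV[R]_n -> \bar R) (l : 'rV[R]_n -> \bar R) : Prop :=
  forall d : 'rV[R]_n,
    (forall u : nat -> 'rV[R]_n, u @ \oo --> d ->
       (l d <= limn_einf (fun k => h k (u k)))%E) /\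
    (exists2 u : nat -> 'rV[R]_n, u @ \oo --> d &
       (limn_esup (fun k => h k (u k)) <= l d)%E).

Definition epi_cvg_at0 (R : realType) (n : nat)
    (h : R -> 'rV[R]_n -> \bar R) (l : 'rV[R]_n -> \bar R) : Prop :=
  forall tau : nat -> R, (forall k, 0 < tau k) -> tau @ \oo --> (0 : R) ->
    epi_cvg_seq (fun k => h (tau k)) l.

Definition is_second_epi_derivative (R : realType) (n : nat)
    (g : 'rV[R]_n -> \bar R) (x v : 'rV[R]_n) (q : 'rV[R]_n -> \bar R) : Prop :=
  epi_cvg_at0 (second_diff_quotient g x v) q /\ proper_fun q.

Definition indicator_ext (R : realType) (n : nat) (S : {vspace 'rV[R]_n})
    (d : 'rV[R]_n) : \bar R :=
  (if d \in S then 0 else +oo)%E.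

(* No normalization of M is imposed: replacing M by P (M + M^T)/2 P, with P the
   orthogonal projection onto S, leaves the quadratic form on S unchanged, so
   taking M symmetric, with range in S and vanishing on the orthogonal
   complement of S, loses no generality. *)
Definition second_order_assumption (R : realType) (n : nat)
    (f : 'rV[R]_n -> R) (g : 'rV[R]_n -> \bar R) (xstar : 'rV[R]_n) : Prop :=
  [/\ (\forall x \near xstar,
         differentiable (grad f) x /\ {for x, continuous (hessian f)}),
      prox_regular g xstar (- grad f xstar) &
      exists (S : {vspace 'rV[R]_n}) (M : 'M[R]_n),
        is_second_epi_derivative g xstar (- grad f xstar)
          (fun d => ((dotp d (d *m M))%:E + indicator_ext S d)%E)].

(* Local single-valuedness of the residual is not automatic for every gamma
   below the critical threshold: for f = 0, xstar = 0 and g' x = x / 2 +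
   x ^ 2 * sin (1 / x) on the line, the threshold is infinite, yet prox is
   multivalued at points arbitrarily close to 0 when gamma = 10. *)
Definition single_valued_around (R : realType) (n : nat)
    (F : 'rV[R]_n -> set 'rV[R]_n) (x0 : 'rV[R]_n) : Prop :=
  \forall x \near x0, exists y, F x = [set y].

(* The single element of F x wherever F is single-valued. *)
Definition value_of (R : realType) (n : nat) (F : 'rV[R]_n -> set 'rV[R]_n)
    (x : 'rV[R]_n) : 'rV[R]_n :=
  xget 0 (F x).

(* Main.v *)
(** Let [T x] be the forward-backward step, [R x = (x - T x) / gamma] and [K x =
    I - gamma H x], where [H] is the Hessian of [f].  In the scaled
    variables [d = (T (xstar + t h) - xstar) / t], the step minimizes the
    second difference quotient of [g] plus [|d - w|^2 / gamma], where [w]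
    tends to [h K xstar]; since these quotients epi-converge to a quadratic
    form on a subspace and [gamma < Gamma xstar] makes the limit problem
    strongly convex, [d] converges to a linear function of [h], so [R] is
    differentiable at [xstar].  The envelope is an infimum of functions
    smooth in [x], attained at [T x]; as [T] is continuous near [xstar], its
    gradient is [R x (K x)^T] there, hence its Hessian at [xstar] is [JR
    K^T].  Since [gamma L < 1], [K] is nonsingular, so positive definiteness
    of that symmetric Hessian amounts to semidefiniteness plus
    nonsingularity of [JR].  Finally [phi (T x) + k |x - T x|^2 <= phi_gamma
    x <= phi x] transfers (strong) local minimality between [phi] and
    [phi_gamma]. *)
Require Import Defs.
From HB Require Import structures.
From mathcomp Require Import all_boot all_order all_algebra.
From mathcomp Require Import all_classical all_reals all_analysis.
From mathcomp Require Import ring lra.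

Set Implicit Arguments.
Unset Strict Implicit.
Unset Printing Implicit Defensive.

Import Order.TTheory GRing.Theory Num.Theory.
Import numFieldNormedType.Exports.

Local Open Scope classical_set_scope.
Local Open Scope ring_scope.

(** * Euclidean structure *)

Section Euclidean.
Context {R : realType} {n : nat}.
Implicit Types (u v w : 'rV[R]_n) (a : R).

Lemma dotpE u v : dotp u v = \sum_i u 0 i * v 0 i.
Proof. by rewrite /dotp mxE; apply: eq_bigr => i _; rewrite mxE. Qed.

Lemma dotpC u v : dotp u v = dotp v u.
Proof. by rewrite !dotpE; apply: eq_bigr => i _; rewrite mulrC. Qed.

Lemma dotpDl u v w : dotp (u + v) w = dotp u w + dotp v w.
Proof. by rewrite /dotp mulmxDl mxE. Qed.

Lemma dotpZl a u v : dotp (a *: u) v = a * dotp u v.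
Proof. by rewrite /dotp -scalemxAl mxE. Qed.

Lemma dotpNl u v : dotp (- u) v = - dotp u v.
Proof. by rewrite -scaleN1r dotpZl mulN1r. Qed.

Lemma dotpDr u v w : dotp w (u + v) = dotp w u + dotp w v.
Proof. by rewrite dotpC dotpDl !(dotpC w). Qed.

Lemma dotpZr a u v : dotp v (a *: u) = a * dotp v u.
Proof. by rewrite dotpC dotpZl dotpC. Qed.

Lemma dotpNr u v : dotp v (- u) = - dotp v u.
Proof. by rewrite dotpC dotpNl dotpC. Qed.

Lemma dotp0l v : dotp 0 v = 0.
Proof. by rewrite /dotp mul0mx mxE. Qed.

Lemma dotp0r v : dotp v 0 = 0.
Proof. by rewrite dotpC dotp0l. Qed.

Definition dotp_lin :=
  (dotpDl, dotpDr, dotpNl, dotpNr, dotpZl, dotpZr, dotp0l, dotp0r).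

Lemma dotpp_ge0 u : 0 <= dotp u u.
Proof. by rewrite dotpE; apply: sumr_ge0 => i _; rewrite -expr2 sqr_ge0. Qed.

Lemma dotpp_eq0 u : (dotp u u == 0) = (u == 0).
Proof.
apply/idP/eqP => [|->]; last by rewrite dotp0l.
rewrite dotpE psumr_eq0; last by move=> i _; rewrite -expr2 sqr_ge0.
move=> /allP u0; apply/rowP => i; rewrite mxE; apply/eqP.
by rewrite -[_ == 0]sqrf_eq0 expr2; apply: u0; rewrite mem_index_enum.
Qed.

Lemma dotpp_gt0 u : (0 < dotp u u) = (u != 0).
Proof. by rewrite lt_neqAle dotpp_ge0 andbT eq_sym dotpp_eq0. Qed.

Lemma dotp_inj u v : (forall w, dotp w u = dotp w v) -> u = v.
Proof.
move=> uv; apply/eqP; rewrite -subr_eq0 -dotpp_eq0 dotpDr dotpNr uv.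
by rewrite subrr.
Qed.

Lemma sqr_enorm u : enorm u ^+ 2 = dotp u u.
Proof. by rewrite sqr_sqrtr// dotpp_ge0. Qed.

Lemma enorm_ge0 u : 0 <= enorm u.
Proof. exact: sqrtr_ge0. Qed.

Lemma enorm_eq0 u : (enorm u == 0) = (u == 0).
Proof. by rewrite -sqrf_eq0 sqr_enorm dotpp_eq0. Qed.

Lemma enormN u : enorm (- u) = enorm u.
Proof. by rewrite /enorm dotpNl dotpNr opprK. Qed.

Lemma enormZ a u : enorm (a *: u) = `|a| * enorm u.
Proof.
by rewrite /enorm !dotp_lin mulrA -expr2 sqrtrM ?sqr_ge0// sqrtr_sqr.
Qed.

(** Cauchy-Schwarz: the squared norm of [<v, v> u - <u, v> v] is nonnegative, and it equals [<v, v>]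
    times the gap between the two sides. *)
Lemma dotp_sqr_le u v : dotp u v ^+ 2 <= dotp u u * dotp v v.
Proof.
have [->|v0] := eqVneq v 0; first by rewrite !dotp0r expr0n mulr0.
have vv : 0 < dotp v v by rewrite dotpp_gt0.
have := dotpp_ge0 (dotp v v *: u - dotp u v *: v).
rewrite !dotp_lin (dotpC v u) => H.
rewrite -(ler_pM2l vv) -subr_ge0; apply: le_trans H _.
by rewrite le_eqVlt; apply/orP; left; apply/eqP; ring.
Qed.

Lemma normr_dotp_le u v : `|dotp u v| <= enorm u * enorm v.
Proof.
rewrite -(@ler_pXn2r _ 2) ?nnegrE ?mulr_ge0 ?enorm_ge0//.
by rewrite exprMn !sqr_enorm real_normK ?num_real// dotp_sqr_le.
Qed.

Lemma dotp_le u v : dotp u v <= enorm u * enorm v.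
Proof. exact: le_trans (ler_norm _) (normr_dotp_le u v). Qed.

Lemma enormD u v : enorm (u + v) <= enorm u + enorm v.
Proof.
rewrite -(@ler_pXn2r _ 2) ?nnegrE ?addr_ge0 ?enorm_ge0//.
rewrite sqr_enorm !dotp_lin (dotpC v u) sqrrD !sqr_enorm.
have := dotp_le u v; lra.
Qed.

Lemma norm_le_enorm u : `|u| <= enorm u.
Proof.
rewrite /Num.Def.normr/= mx_normrE; apply/bigmax_leP.
split; first exact: enorm_ge0.
move=> [i j] _ /=; rewrite -(@ler_pXn2r _ 2) ?nnegrE ?enorm_ge0//.
rewrite sqr_enorm dotpE real_normK ?num_real// (bigD1 j)//= (ord1 i) -expr2.
by rewrite lerDl; apply: sumr_ge0 => k _; rewrite -expr2 sqr_ge0.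
Qed.

Lemma norm_coord_le u i : `|u 0 i| <= `|u|.
Proof.
rewrite [leRHS]/Num.Def.normr/= mx_normrE.
by apply/bigmax_geP; right => /=; exists (0, i).
Qed.

(** The crude factor [n + 1] is positive even when [n = 0], so tolerances can be divided by it when
    passing between the two norms. *)
Lemma enorm_le_norm u : enorm u <= n.+1%:R * `|u|.
Proof.
rewrite -(@ler_pXn2r _ 2) ?nnegrE ?mulr_ge0 ?enorm_ge0//.
rewrite sqr_enorm dotpE exprMn.
apply: (@le_trans _ _ (\sum_(i < n) `|u| ^+ 2)).
  apply: ler_sum => i _; rewrite -expr2 -(real_normK (num_real (u 0 i))).
  by rewrite ler_pXn2r ?nnegrE// norm_coord_le.
rewrite sumr_const card_ord -[leLHS]mulr_natl ler_wpM2r ?sqr_ge0// expr2 -natrM.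
by rewrite ler_nat (leq_trans (leqnSn n))// leq_pmulr.
Qed.

Lemma cvg_dotp {T : Type} (F : set_system T) {FF : Filter F}
    (p q : T -> 'rV[R]_n) u v :
  p @ F --> u -> q @ F --> v -> (fun t => dotp (p t) (q t)) @ F --> dotp u v.
Proof.
move=> pu qv; under eq_cvg do rewrite dotpE.
rewrite dotpE; apply: cvg_big => [|i _]; first exact: add_continuous.
apply: cvgM.
  exact: (cvg_comp _ (fun w => w 0 i) pu (@coord_continuous _ _ _ 0 i u)).
exact: (cvg_comp _ (fun w => w 0 i) qv (@coord_continuous _ _ _ 0 i v)).
Qed.

(** The linear structure lets [dotp u] serve as a candidate differential in [is_diff_epsP]. *)
HB.instance Definition _ u := GRing.isLinear.Build R 'rV[R]_n R _ (dotp u)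
  (fun a v w => etrans (dotpDr _ _ _) (congr1 (+%R^~ _) (dotpZr _ _ _))).

Lemma continuous_dotp u : continuous (dotp u).
Proof.
move=> v; exact: (@cvg_dotp _ (nbhs v) _ (cst u) id u v
  (@cvg_cst _ u _ _ _) (@cvg_id _ (nbhs v))).
Qed.

End Euclidean.

Section EuclideanMatrix.
Context {R : realType}.

Lemma dotp_mull m n (u : 'rV[R]_m) (A : 'M[R]_(m, n)) (v : 'rV[R]_n) :
  dotp (u *m A) v = dotp u (v *m A^T).
Proof. by rewrite /dotp trmx_mul trmxK mulmxA. Qed.

Lemma dotp_mulr m n (u : 'rV[R]_m) (A : 'M[R]_(m, n)) (v : 'rV[R]_n) :
  dotp v (u *m A) = dotp (v *m A^T) u.
Proof. by rewrite dotpC dotp_mull dotpC. Qed.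

Lemma dotp_delta n (u : 'rV[R]_n) i : dotp u (delta_mx 0 i) = u 0 i.
Proof. by rewrite /dotp trmx_delta -colE mxE. Qed.

Lemma cvg_mulmxr {T : Type} (F : set_system T) {FF : Filter F} m n
    (p : T -> 'rV[R]_m) (u : 'rV[R]_m) (A : 'M[R]_(m, n)) :
  p @ F --> u -> (fun t => p t *m A) @ F --> u *m A.
Proof.
move=> pu; under eq_cvg do rewrite mulmx_sum_row.
rewrite mulmx_sum_row; apply: cvg_big => [|i _]; first exact: add_continuous.
apply: cvgZr_tmp.
exact: (cvg_comp _ (fun w => w 0 i) pu (@coord_continuous _ _ _ 0 i u)).
Qed.

Lemma continuous_mulmxr m n (A : 'M[R]_(m, n)) :
  continuous (fun u : 'rV[R]_m => u *m A).
Proof.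
move=> u.
exact: (@cvg_mulmxr _ (nbhs u) _ _ _ id u A (@cvg_id _ (nbhs u))).
Qed.

End EuclideanMatrix.

(** * Sequential criteria and compactness *)

Section Sequences.
Context {R : realType}.

Lemma cvg_harmonic_dist {V : normedModType R} (u : nat -> V) (l : V) :
  (forall k, `|l - u k| < k.+1%:R^-1) -> u @ \oo --> l.
Proof.
move=> ul; apply/cvgrPdist_lt => _/posnumP[e].
near=> k; apply: lt_trans (ul k) _.
by near: k; exact: near_infty_natSinv_lt.
Unshelve. all: by end_near. Qed.

(** If [P] failed in every ball of radius [1 / (k + 1)], failing points would form a sequence
    tending to [x]. This turns neighbourhood claims into claims about sequences, the form in which
    epi-convergence is given. *)
Lemma near_seqP {V : normedModType R} (x : V) (P : set V) :
  (forall u : nat -> V, u @ \oo --> x -> exists k, P (u k)) ->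
  \forall y \near x, P y.
Proof.
move=> xP; apply: contrapT => nP.
have /choice[u uP] k : exists y, `|x - y| < k.+1%:R^-1 /\ ~ P y.
  apply: contrapT => H; apply: nP; apply/nbhs_ballP.
  exists k.+1%:R^-1 => //= y; rewrite -ball_normE /= => xy.
  by apply: contrapT => Py; apply: H; exists y.
have [|k Pk] := xP u; first by apply: cvg_harmonic_dist => k; case: (uP k).
by have [] := uP k.
Qed.

Lemma cvg_subseq {T : topologicalType} (u : nat -> T) (l : T) (s : nat -> nat) :
  (forall k, (k <= s k)%N) -> u @ \oo --> l -> (u \o s) @ \oo --> l.
Proof.
move=> sk; apply: cvg_comp => A [N _ NA]; exists N => // k /= Nk.
by apply: NA => /=; exact: leq_trans (sk k).
Qed.

Lemma bounded_cvg_subseq n (u : nat -> 'rV[R]_n) (M : R) :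
  (forall k, `|u k| <= M) ->
  exists2 s : nat -> nat, (forall k, (k <= s k)%N) &
    exists l : 'rV[R]_n, (u \o s) @ \oo --> l.
Proof.
move=> uM; have : compact (closed_ball_ Num.Def.normr (0 : 'rV[R]_n) M).
  apply: bounded_closed_compact (@closed_closed_ball_ _ _ _ _).
  exists M; split; first exact: num_real.
  move=> N MN v; rewrite /closed_ball_/= sub0r normrN => /le_trans; apply.
  exact: ltW.
move=> /(_ (u @ \oo) _)[].
  by exists 0%N => // k _; rewrite /closed_ball_/= sub0r normrN.
move=> l [_ ul].
have /choice[s sP] k : exists p, (k <= p)%N /\ `|l - u p| < k.+1%:R^-1.
  have [] := ul (u @` [set p | (k <= p)%N]) (ball l k.+1%:R^-1).
  - by exists k => // p /= kp; exists p.
  - exact: nbhsx_ballx.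
  by move=> _ [[p /= kp <-]]; rewrite -ball_normE; exists p.
exists s; first by move=> k; exact: (sP k).1.
by exists l; apply: cvg_harmonic_dist => k; exact: (sP k).2.
Qed.

End Sequences.

(** * Differentials *)

Section FrechetDerivative.
Context {R : realType}.

Lemma is_diff_epsP {V W : normedModType R} (F : V -> W) (x : V)
    (df : {linear V -> W}) :
  continuous df ->
  (forall e : R, 0 < e ->
     \forall h \near (0 : V), `|F (x + h) - F x - df h| <= e * `|h|) ->
  differentiable F x /\ 'd F x = df :> (V -> W).
Proof.
move=> dfc Fdf.
have E : F \o shift x = cst (F x) + df +o_ (0 : V) id.
  apply/eqaddoP => e e0; near=> h.
  rewrite -[(_ - _) h]/(F (h + x) - (F x + df h)) opprD addrA addrC.
  rewrite (addrC h) addrC.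
  by near: h; exact: Fdf.
have D := diff_unique dfc E; split => //.
by apply/diff_locallyP; rewrite D.
Unshelve. all: by end_near. Qed.

Lemma differentiable_eps {V W : normedModType R} (F : V -> W) (x : V) (e : R) :
  differentiable F x -> 0 < e ->
  \forall h \near (0 : V), `|F (x + h) - F x - 'd F x h| <= e * `|h|.
Proof.
move=> /diff_locally/eqaddoP/(_ e) /[apply]; apply: filterS => h.
rewrite -[(_ - _) h]/(F (h + x) - (F x + 'd F x h)) opprD addrA.
by rewrite (addrC h).
Qed.

Lemma diff_translate {V W : normedModType R} (f : V -> W) (x c : V) :
  differentiable f (x + c) ->
  differentiable (fun z => f (z + c)) x /\
  'd (fun z => f (z + c)) x = 'd f (x + c) :> (V -> W).
Proof.
move=> fx; apply: is_diff_epsP; first exact: diff_continuous.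
move=> e e0; apply: filterS (differentiable_eps fx e0) => h.
by rewrite (addrAC x h c).
Qed.

(** Balls around 0 are star-shaped, so the property holds on the whole segment from 0 to [h], as the
    mean value theorem requires. *)
Lemma near0_segment {V : normedModType R} (P : set V) :
  (\forall h \near (0 : V), P h) ->
  \forall h \near (0 : V), forall s : R, 0 <= s <= 1 -> P (s *: h).
Proof.
move=> /nbhs_ballP[e /= e0 eP]; apply/nbhs_ballP; exists e => //= h.
rewrite -ball_normE/= sub0r normrN => he s /andP[s0 s1]; apply: eP.
rewrite -ball_normE/= sub0r normrN normrZ ger0_norm//.
by apply: le_lt_trans he; rewrite ler_piMl.
Qed.

Lemma near_shift0 {V : normedModType R} (P : set V) (x : V) :
  (\forall y \near x, P y) <-> (\forall h \near (0 : V), P (x + h)).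
Proof.
split=> /nbhs_ballP[e /= e0 eP]; apply/nbhs_ballP; exists e => //= h.
  rewrite -ball_normE/= sub0r normrN => he; apply: eP.
  by rewrite -ball_normE/= opprD addNKr normrN.
rewrite -ball_normE/= => he; rewrite -(subrK x h) addrC; apply: eP.
by rewrite -ball_normE/= sub0r opprB.
Qed.

(** Mean value theorem for [f (x + s h) - q s ^ 2 / 2] on [[0, 1]]. The free constant [q] has three
    uses: 0 gives the first-order form, the Hessian form at [h] gives Taylor's formula, and
    [L |h| ^ 2] gives the descent inequality. *)
Lemma mvt_segment {V : normedModType R} (f : V -> R) (x h : V) (q : R) :
  (forall s : R, 0 <= s <= 1 -> differentiable f (x + s *: h)) ->
  exists2 s : R, 0 < s < 1 &
    f (x + h) - f x - q / 2 = 'd f (x + s *: h) h - s * q.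
Proof.
move=> fd; pose g := fun s : R => f (x + s *: h).
have gd (s : R) : 0 <= s <= 1 -> is_derive s 1 g ('d f (x + s *: h) h).
  move=> s01; have D : is_diff s (fun s : R => x + s *: h) ( *:%R ^~ h).
    by apply: is_diff_eq; rewrite add0r.
  have fD : differentiable f ((fun s : R => x + s *: h) s) by exact: fd.
  have gE : g = f \o (fun s : R => x + s *: h) by [].
  have gdiff : differentiable g s.
    by rewrite gE; apply: differentiable_comp.
  split; first exact: diff_derivable.
  by rewrite deriveE// gE diff_comp//= diff_val/= scale1r.
pose k := fun s : R => g s - q / 2 * s ^+ 2.
have kd (s : R) : 0 <= s <= 1 -> is_derive s 1 k ('d f (x + s *: h) h - s * q).
  by move=> /gd gds; apply: is_derive_eq; rewrite /GRing.scale/=; field.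
have [] := @MVT R k (fun s => 'd f (x + s *: h) h - s * q) 0 1 ltr01.
- by move=> t; rewrite in_itv/= => /andP[t0 t1]; apply: kd; rewrite !ltW.
- apply: derivable_within_continuous => t; rewrite in_itv/= => s01.
  by have [] := kd _ s01.
move=> s; rewrite in_itv/= /k /g scale1r scale0r addr0 => s01 ks.
by exists s => //; apply: etrans (etrans ks _); ring.
Qed.

(** The second difference is the increment along [h] of [f (z + k) - f z], to which the mean value
    theorem applies. *)
Lemma mvt_second_difference {V : normedModType R} (f : V -> R) (x h k : V) :
  (forall s : R, 0 <= s <= 1 -> differentiable f (x + s *: h) /\
                                differentiable f (x + s *: h + k)) ->
  exists2 s : R, 0 < s < 1 &
    f (x + h + k) - f (x + h) - f (x + k) + f x =
    'd f (x + s *: h + k) h - 'd f (x + s *: h) h.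
Proof.
move=> fd; pose g := fun z => f (z + k).
have gd (s : R) : 0 <= s <= 1 -> differentiable (g - f) (x + s *: h).
  by move=> /fd[fs /diff_translate[gs _]]; exact: differentiableB.
have [s s01 Hs] := mvt_segment 0 gd; exists s => //.
have /fd[fs /diff_translate[gs dg]] : 0 <= s <= 1.
  by case/andP: s01 => ? ?; rewrite !ltW.
rewrite -dg; transitivity ('d (g - f) (x + s *: h) h - s * 0).
  by rewrite -Hs mul0r subr0 -![(g - f) _]/(f _ - f _); ring.
by rewrite mulr0 subr0 diffB.
Qed.

(* Both [H h k] and [H k h] are limits, as t tends to 0, of the symmetric
   difference quotient
   [(f (x + t h + t k) - f (x + t h) - f (x + t k) + f x) / t ^ 2]. *)
Lemma schwarz {V : normedModType R} (f : V -> R) (x : V) (df H : V -> V -> R) :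
  (forall u v w, H (u + v) w = H u w + H v w) ->
  (forall a u v, H (a *: u) v = a * H u v) ->
  (forall a u v, H u (a *: v) = a * H u v) ->
  (\forall y \near x, differentiable f y) ->
  (forall y k, 'd f y k = df y k) ->
  (forall e : R, 0 < e -> \forall u \near (0 : V), forall k,
     `|df (x + u) k - df x k - H u k| <= e * `|u| * `|k|) ->
  forall h k, H h k = H k h.
Proof.
move=> HD HZl HZr /near_shift0 fd dfE Hf h k.
pose N := `|h| + `|k|.
have N0 : 0 <= N by rewrite addr_ge0.
have N1 : 0 < N ^+ 2 + 1 by rewrite ltr_wpDl ?sqr_ge0.
(* The bound depends on [h] and [k] only through [N], which is symmetric in them, so it can be used
   in both orders and compared. *)
suff key (e : R) : 0 < e -> forall h k, `|h| + `|k| = N ->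
    exists2 t0 : R, 0 < t0 & forall t, 0 < t -> t < t0 ->
    `|(f (x + t *: h + t *: k) - f (x + t *: h) - f (x + t *: k) + f x)
       - t ^+ 2 * H k h| <= 2 * e * (t ^+ 2 * N ^+ 2).
  apply/eqP; rewrite -subr_eq0 -normr_le0; apply/ler_addgt0Pr => e e0.
  rewrite add0r.
  (* Two errors of size [2 e' t ^ 2 N ^ 2] add up; this [e'] keeps their sum below [t ^ 2 e]. *)
  have eN : 0 < e / (4 * (N ^+ 2 + 1)) by rewrite divr_gt0// mulr_gt0.
  have [t1 t10 B1] := key _ eN h k erefl.
  have [t2 t20 B2] := key _ eN k h (addrC _ _).
  pose t := Num.min t1 t2 / 2.
  have mt : 0 < Num.min t1 t2 by rewrite lt_min t10.
  have t0 : 0 < t by rewrite divr_gt0.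
  have : t < Num.min t1 t2 by rewrite ltr_pdivrMr// ltr_pMr// ltr1n.
  rewrite lt_min => /andP[tt1 tt2].
  have {tt1}B1 := B1 t t0 tt1; have {tt2}B2 := B2 t t0 tt2.
  rewrite (addrAC x (t *: k)) in B2; move: B1 B2.
  move: (f (x + t *: h + t *: k)) (f (x + t *: h)) (f (x + t *: k)) (f x).
  move: (H h k) (H k h) => a b c1 c2 c3 c4 B1 B2.
  have tt0 : 0 < t ^+ 2 by rewrite exprn_gt0.
  rewrite -(ler_pM2l tt0) -{1}(gtr0_norm tt0) -normrM.
  apply: (@le_trans _ _ (4 * (e / (4 * (N ^+ 2 + 1))) * (t ^+ 2 * N ^+ 2))).
    by move: B1 B2; rewrite !ler_norml => /andP[? ?] /andP[? ?]; lra.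
  rewrite -subr_ge0.
  have -> : t ^+ 2 * e - 4 * (e / (4 * (N ^+ 2 + 1))) * (t ^+ 2 * N ^+ 2)
    = t ^+ 2 * e / (N ^+ 2 + 1) by field; rewrite gt_eqF.
  by rewrite !mulr_ge0// ?invr_ge0 ltW.
move: N N0 N1 => N N0 N1 e0 {}h {}k hkN.
have /nbhs_ballP[d /= d0 dP] : \forall u \near (0 : V),
    differentiable f (x + u) /\ forall k,
    `|'d f (x + u) k - 'd f x k - H u k| <= e * `|u| * `|k|.
  near=> u; split; [|move=> k'; rewrite !dfE; move: k']; near: u => //.
  exact: Hf.
exists (d / (N + 1)); first by rewrite divr_gt0// ltr_wpDl.
move=> t t0; rewrite ltr_pdivlMr ?ltr_wpDl// => td.
have {}dP (u : V) : `|u| <= t * N -> differentiable f (x + u) /\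
    `|'d f (x + u) (t *: h) - 'd f x (t *: h) - H u (t *: h)|
       <= e * (t ^+ 2 * N ^+ 2).
  move=> uN; have /dP[fu Hu] : ball 0 d u.
    rewrite -ball_normE/= sub0r normrN; apply: le_lt_trans uN _.
    by apply: lt_trans td; rewrite ltr_pM2l// ltrDl.
  split => //; apply: le_trans (Hu _) _; rewrite -mulrA ler_pM2l//.
  have -> : t ^+ 2 * N ^+ 2 = (t * N) * (t * N) by ring.
  by rewrite ler_pM// normrZ gtr0_norm// ler_pM2l// -hkN lerDl.
have hN (s : R) : 0 <= s <= 1 -> `|s *: (t *: h)| <= t * `|h|.
  move=> /andP[s0 s1]; rewrite scalerA normrZ ger0_norm ?mulr_ge0 ?(ltW t0)//.
  by rewrite ler_wpM2r// ler_piMl// ltW.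
have hN1 (s : R) : 0 <= s <= 1 -> `|s *: (t *: h)| <= t * N.
  by move=> /hN /le_trans; apply; rewrite ler_pM2l// -hkN lerDl.
have hN2 (s : R) : 0 <= s <= 1 -> `|s *: (t *: h) + t *: k| <= t * N.
  move=> /hN sh; apply: le_trans (ler_normD _ _) _.
  by rewrite -hkN mulrDr lerD// normrZ gtr0_norm.
have [|s /andP[s0 s1] ->] := @mvt_second_difference V f x (t *: h) (t *: k).
  move=> s s01; split; first by have [] := dP _ (hN1 _ s01).
  by rewrite -addrA; have [] := dP _ (hN2 _ s01).
have s01 : 0 <= s <= 1 by rewrite !ltW.
have [_ B1] := dP _ (hN1 _ s01); have [_ B2] := dP _ (hN2 _ s01).
(* Additivity of [H] cancels the terms in [H (s t h)], leaving [t ^ 2 H k h]. *)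
move: B1 B2; rewrite addrA HD !HZl !HZr.
move: ('d f _ _) ('d f (x + _) _) ('d f x _) (H h h) (H k h) => a b c p q.
by rewrite !ler_norml => /andP[? ?] /andP[? ?]; lra.
Unshelve. all: by end_near. Qed.

End FrechetDerivative.

Section GradJacobian.
Context {R : realType} {m n : nat}.
Implicit Types (F : 'rV[R]_m -> 'rV[R]_n) (f : 'rV[R]_m -> R).

Lemma jacobian_eps F x (e : R) : differentiable F x -> 0 < e ->
  \forall h \near (0 : 'rV[R]_m),
    enorm (F (x + h) - F x - h *m 'J F x) <= e * enorm h.
Proof.
move=> Fx e0; have eN : 0 < e / n.+1%:R by rewrite divr_gt0.
apply: filterS (differentiable_eps Fx eN) => h.
rewrite -[h *m _]/(h *m lin1_mx _) mul_rV_lin1 => He.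
apply: le_trans (enorm_le_norm _) _.
rewrite mulrC -ler_pdivlMr// mulrAC; apply: le_trans He _.
by rewrite ler_pM2l// norm_le_enorm.
Qed.

Lemma jacobian_unique F x (A : 'M[R]_(m, n)) :
  (forall e : R, 0 < e -> \forall h \near (0 : 'rV[R]_m),
     enorm (F (x + h) - F x - h *m A) <= e * enorm h) ->
  differentiable F x /\ 'J F x = A.
Proof.
move=> FA; have [||Fx dF] := @is_diff_epsP R _ _ F x (mulmxr A).
- exact: continuous_mulmxr.
- move=> e e0; have eN : 0 < e / m.+1%:R by rewrite divr_gt0.
  apply: filterS (FA _ eN) => h He.
  apply: le_trans (norm_le_enorm _) _; apply: le_trans He _.
  by rewrite mulrAC ler_pdivrMr// -mulrA ler_pM2l// mulrC enorm_le_norm.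
split => //; apply/row_matrixP => i.
by rewrite !rowE /jacobian mul_rV_lin1 dF.
Qed.

Lemma diff_grad f x h : 'd f x h = dotp (grad f x) h.
Proof.
rewrite {1}(row_sum_delta h) linear_sum dotpE; apply: eq_bigr => i _.
by rewrite linearZ/= mxE mulrC.
Qed.

Lemma grad_eps f x (e : R) : differentiable f x -> 0 < e ->
  \forall h \near (0 : 'rV[R]_m),
    `|f (x + h) - f x - dotp (grad f x) h| <= e * enorm h.
Proof.
move=> fx e0; apply: filterS (differentiable_eps fx e0) => h.
rewrite diff_grad// => /le_trans; apply.
by rewrite ler_pM2l// norm_le_enorm.
Qed.

Lemma grad_unique f x v :
  (forall e : R, 0 < e -> \forall h \near (0 : 'rV[R]_m),
     `|f (x + h) - f x - dotp v h| <= e * enorm h) ->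
  differentiable f x /\ grad f x = v.
Proof.
move=> fv; have [||fx df] := @is_diff_epsP R _ _ f x (dotp v).
- exact: continuous_dotp.
- move=> e e0; have eN : 0 < e / m.+1%:R by rewrite divr_gt0.
  apply: filterS (fv _ eN) => h He; apply: le_trans He _.
  by rewrite mulrAC ler_pdivrMr// -mulrA ler_pM2l// mulrC enorm_le_norm.
split => //; apply/rowP => i.
by rewrite mxE df; exact: dotp_delta.
Qed.

End GradJacobian.

(** * Second-order Taylor expansion, descent inequality and symmetry of the Hessian *)

Section SecondOrder.
Context {R : realType} {n : nat}.
Implicit Types (f : 'rV[R]_n -> R) (x h k : 'rV[R]_n).

(** Taking [q] to be the Hessian form in [mvt_segment] leaves as remainder the first-order error of
    the gradient at [x + s h], paired with [h]; that error is at most [e |h|]. *)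
Lemma taylor2 f x (e : R) :
  (\forall y \near x, differentiable f y) -> differentiable (grad f) x ->
  0 < e ->
  \forall h \near (0 : 'rV[R]_n),
    `|f (x + h) - f x - dotp (grad f x) h - dotp (h *m hessian f x) h / 2|
      <= e * enorm h ^+ 2.
Proof.
move=> /near_shift0/near0_segment fd gd e0.
have /near0_segment Hg := jacobian_eps gd e0.
near=> h.
have /(_ _)/= fdh : forall s : R, 0 <= s <= 1 -> differentiable f (x + s *: h).
  by near: h.
have /(_ _)/= Hh : forall s : R, 0 <= s <= 1 ->
    enorm (grad f (x + s *: h) - grad f x - (s *: h) *m hessian f x)
      <= e * enorm (s *: h).
  by near: h.
set q := dotp (h *m hessian f x) h.
have [s /andP[s0 s1] fs] := mvt_segment q fdh.
have s01 : 0 <= s <= 1 by rewrite !ltW.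
rewrite addrAC fs diff_grad.
have -> : dotp (grad f (x + s *: h)) h - s * q - dotp (grad f x) h =
    dotp (grad f (x + s *: h) - grad f x - (s *: h) *m hessian f x) h.
  rewrite -scalemxAl /q; move: (grad f (x + _)) (grad f x) (h *m _) => a b c.
  by rewrite !dotp_lin; ring.
apply: le_trans (normr_dotp_le _ _) _.
rewrite expr2 mulrA ler_wpM2r ?enorm_ge0//; apply: le_trans (Hh s s01) _.
by rewrite ler_pM2l// enormZ ger0_norm ?(ltW s0)// ler_piMl ?enorm_ge0// ltW.
Unshelve. all: by end_near. Qed.

(** With [q = L |h| ^ 2] in [mvt_segment], the remainder [<grad f (x + s h) - grad f x, h> - s q] is
    nonpositive by Cauchy-Schwarz and the Lipschitz bound. *)
Lemma descent f x h (L : R) : (forall y, differentiable f y) ->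
  (forall y z, enorm (grad f y - grad f z) <= L * enorm (y - z)) ->
  f (x + h) <= f x + dotp (grad f x) h + L / 2 * enorm h ^+ 2.
Proof.
move=> fd; have dg y k : 'd f y k = dotp (grad f y) k by exact: diff_grad.
move: (grad f) dg => G dg fL; have [s /andP[s0 s1] fs] :=
  mvt_segment (L * enorm h ^+ 2) (fun s (_ : 0 <= s <= 1) => fd (x + s *: h)).
have E : x + s *: h - x = s *: h by rewrite addrC addKr.
move: (x + s *: h) E fs => y E; rewrite dg => fs.
have : dotp (G y - G x) h <= s * (L * enorm h ^+ 2).
  apply: le_trans (dotp_le _ _) _.
  have := ler_wpM2r (enorm_ge0 h) (fL y x).
  rewrite E enormZ (gtr0_norm s0) => /le_trans; apply.
  by rewrite le_eqVlt; apply/orP; left; apply/eqP; ring.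
by move: (x + h) fs => z fs; rewrite dotpDl dotpNl; move: fs; lra.
Qed.

Lemma hessian_sym f x :
  (\forall y \near x, differentiable f y) -> differentiable (grad f) x ->
  (hessian f x)^T = hessian f x.
Proof.
move=> fd gd.
have dg y k : 'd f y k = dotp (grad f y) k by exact: diff_grad.
have {gd} := fun e => @jacobian_eps _ _ _ _ _ e gd.
rewrite -/(hessian f x); move: (hessian f x) (grad f) dg => H G dg gd.
have sym : forall h k, dotp (h *m H) k = dotp (k *m H) h.
  apply: (@schwarz R _ f x (fun y k => dotp (G y) k)
                   (fun h k => dotp (h *m H) k)) => //.
  - by move=> u v w; rewrite mulmxDl dotpDl.
  - by move=> a u v; rewrite -scalemxAl dotpZl.
  - by move=> a u v; rewrite dotpZr.
  (* One factor [n + 1] is lost for each of the Euclidean norms of [u] and [k]. *)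
  move=> e e0; have eN : 0 < e / n.+1%:R ^+ 2 by rewrite divr_gt0// exprn_gt0.
  apply: filterS (gd _ eN) => u Hu k.
  move: (G (x + u)) (G x) (u *m H) Hu => a b c Hu.
  rewrite -!dotpNl -!dotpDl; apply: le_trans (normr_dotp_le _ _) _.
  have := ler_pM (enorm_ge0 _) (enorm_ge0 _)
    (le_trans Hu (ler_wpM2l (ltW eN) (enorm_le_norm u))) (enorm_le_norm k).
  move=> /le_trans; apply; rewrite le_eqVlt; apply/orP; left; apply/eqP.
  by field; rewrite ?nat1r ?natr1 pnatr_eq0.
apply/trmx_inj; rewrite trmxK; apply/row_matrixP => i; apply: dotp_inj => w.
by rewrite !rowE !(dotpC w) [RHS]dotp_mull trmxK [RHS]dotpC sym.
Qed.

End SecondOrder.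

(** * Epi-convergence *)

Section EpiConvergence.
Context {R : realType}.
Local Open Scope ereal_scope.

Lemma limn_einf_le (u : nat -> \bar R) (b : \bar R) :
  (\forall k \near \oo, u k <= b) -> limn_einf u <= b.
Proof.
move=> ub; apply: le_trans (limn_einf_sup u) _.
apply: (@le_trans _ _ (ereal_sup (u @` [set k | u k <= b]))).
  by apply: ereal_inf_lbound; exists [set k | u k <= b].
by apply: ge_ereal_sup => _ [k /= kb <-].
Qed.

Lemma limn_esup_lt (u : nat -> \bar R) (b : \bar R) :
  limn_esup u < b -> \forall k \near \oo, u k < b.
Proof.
move=> /ereal_inf_lt[_ [V Voo <-]] Vb.
apply: filterS Voo => k Vk; apply: le_lt_trans Vb.
by apply: ereal_sup_ubound; exists k.
Qed.

End EpiConvergence.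

Section SecondDiffQuotient.
Context {R : realType} {n : nat}.
Implicit Types (g : 'rV[R]_n -> \bar R) (x v d u w : 'rV[R]_n).

Lemma second_diff_quotient_le g x v d (gx tau b : R) :
  g x = gx%:E -> 0 < tau ->
  (second_diff_quotient g x v tau d <= b%:E)%E =
  (g (x + tau *: d)%R <= (gx + tau * dotp v d + tau ^+ 2 / 2 * b)%:E)%E.
Proof.
move=> gxE tau0; rewrite /second_diff_quotient gxE.
have t2 : 0 < tau ^+ 2 / 2 by rewrite divr_gt0// exprn_gt0.
rewrite inver gt_eqF// lee_pdivrMr// !leeBlDr// -EFinM -!EFinD.
congr (_ <= _%:E)%E; ring.
Qed.

End SecondDiffQuotient.

(** * Quadratic minimization over a subspace *)

Section ConstrainedArgmin.
Context {R : realType} {n : nat}.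
Implicit Types (S : {vspace 'rV[R]_n}) (M : 'M[R]_n).

Definition basis_mx S : 'M[R]_(\dim S, n) := \matrix_i (vbasis S)`_i.

Lemma basis_mxP S d : d \in S -> exists c, d = c *m basis_mx S.
Proof.
move=> /coord_vbasis dE; exists (\row_i coord (vbasis S) i d).
rewrite mulmx_sum_row {1}dE; apply: eq_bigr => i _.
by rewrite rowK mxE.
Qed.

Lemma mem_basis_mx S (c : 'rV[R]_(\dim S)) : c *m basis_mx S \in S.
Proof.
rewrite mulmx_sum_row; apply: memv_suml => i _; rewrite rowK memvZ//.
by apply: vbasis_mem; rewrite mem_nth// size_tuple.
Qed.

Lemma basis_mx_inj S (c : 'rV[R]_(\dim S)) : c *m basis_mx S = 0 -> c = 0.
Proof.
rewrite mulmx_sum_row => c0; apply/rowP => i; rewrite mxE.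
have /freeP := basis_free (vbasisP S); apply.
by rewrite -[RHS]c0; apply: eq_bigr => j _; rewrite rowK.
Qed.

Lemma inj_unitmx m (K : 'M[R]_m) :
  (forall u : 'rV[R]_m, u *m K = 0 -> u = 0) -> K \in unitmx.
Proof.
move=> K0; rewrite -row_free_unit -kermx_eq0; apply/eqP/row_matrixP => i.
by rewrite row0; apply: K0; rewrite -row_mul mulmx_ker row0.
Qed.

(* [d |-> <d, d M> + c |d - w|^2] on [S] has its minimizer at
   [w B^T (B E B^T)^-1 (c B)], where the rows of [B] are a basis of [S] and [E]
   is the symmetric part of [M + c I]. *)
Lemma constrained_argmin S M (c a : R) : 0 < a ->
  (forall d, d \in S -> a * dotp d d <= dotp d (d *m M) + c * dotp d d) ->
  exists A : 'M[R]_n, forall w, w *m A \in S /\ forall d, d \in S ->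
    dotp (w *m A) (w *m A *m M) + c * dotp (w *m A - w) (w *m A - w)
      + a * dotp (d - w *m A) (d - w *m A) <=
    dotp d (d *m M) + c * dotp (d - w) (d - w).
Proof.
move=> a0 Mpos; pose B := basis_mx S.
pose E := 2^-1 *: (M + M^T) + c%:M.
have EE d e : dotp (d *m E) e =
    2^-1 * (dotp (d *m M) e + dotp (e *m M) d) + c * dotp d e.
  rewrite /E mulmxDr -scalemxAr mulmxDr mul_mx_scalar !dotp_lin.
  by rewrite (dotp_mull d M^T) trmxK (dotpC d).
have Epos d : d \in S -> a * dotp d d <= dotp (d *m E) d.
  by move=> /Mpos; rewrite EE dotpC; lra.
(* [K] is the matrix of the form [E] in the coordinates of [B]; positivity of [E] on [S] makes it
   injective. *)
pose K := B *m E *m B^T.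
have Ku : K \in unitmx.
  apply: inj_unitmx => u uK; apply: (@basis_mx_inj S); apply/eqP.
  rewrite -dotpp_eq0 eq_le dotpp_ge0 andbT -(pmulr_rle0 _ a0).
  apply: le_trans (Epos _ (mem_basis_mx u)) _.
  by rewrite dotp_mulr -/B -!mulmxA (mulmxA B) -/K uK dotp0l.
exists (c *: (B^T *m invmx K *m B)) => w.
set d0 := w *m _; have d0E : d0 = (c *: (w *m B^T *m invmx K)) *m B.
  by rewrite /d0 -scalemxAl -scalemxAr !mulmxA.
have d0S : d0 \in S by rewrite d0E mem_basis_mx.
have opt e : e \in S -> dotp (d0 *m E) e = c * dotp w e.
  move=> /basis_mxP[t ->]; rewrite -/B dotp_mulr d0E -!scalemxAl dotpZl.
  rewrite -!mulmxA (mulmxA B) -/K mulVmx// mulmx1.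
  by rewrite dotp_mull trmxK.
split => // d dS; have eS : d - d0 \in S by rewrite memvB.
have := Epos _ eS; have := opt _ eS; rewrite !EE.
(* Expanding about [d0], the linear terms cancel by the optimality condition [opt], and what remains
   is [<e E, e> >= a |e| ^ 2]. *)
have -> : d = d0 + (d - d0) by rewrite addrC subrK.
move: (d - d0) => e.
have -> : d0 + e - d0 = e by rewrite addrC addKr.
rewrite !mulmxDl !dotp_lin (dotpC e w) (dotpC e d0) (dotpC (d0 *m M)).
rewrite (dotpC (e *m M)) (dotpC w d0) (dotpC (e *m M) e).
move: (dotp d0 d0) (dotp e e) (dotp d0 e) (dotp w e) (dotp d0 w).
move: (dotp d0 (d0 *m M)) (dotp e (e *m M)) (dotp e (d0 *m M)).
move: (dotp d0 (e *m M)) (dotp w w).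
move=> b1 b2 b3 b4 b5 b6 b7 b8 b9 b10; lra.
Qed.

End ConstrainedArgmin.

(** * Consequences of twice epi-differentiability *)

Section EpiDerivative.
Context {R : realType} {n : nat}.
Variables (g : 'rV[R]_n -> \bar R) (x v : 'rV[R]_n) (gx : R).
Variables (S : {vspace 'rV[R]_n}) (M : 'M[R]_n) (c : R).

Let q (d : 'rV[R]_n) : \bar R :=
  ((dotp d (d *m M))%:E + indicator_ext S d)%E.

Hypothesis gxE : g x = gx%:E.
Hypothesis g_epi : is_second_epi_derivative g x v q.
Hypothesis g_ge : forall z,
  ((gx + dotp v (z - x) - c / 2 * dotp (z - x) (z - x))%:E <= g z)%E.

(** The strict inequality leaves room: along a recovery sequence the quotients have upper limit at
    most [q d], hence are eventually below [b]. *)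
Lemma epi_recovery d (tau : nat -> R) (b : R) :
  (forall k, 0 < tau k) -> tau @ \oo --> (0 : R) ->
  d \in S -> dotp d (d *m M) < b ->
  exists2 u : nat -> 'rV[R]_n, u @ \oo --> d &
    \forall k \near \oo, (second_diff_quotient g x v (tau k) (u k) <= b%:E)%E.
Proof.
move=> tau0 tauc dS db; have [epi _] := g_epi.
have [_ [u ud ub]] := epi tau tau0 tauc d.
exists u => //.
have : (q d < b%:E)%E by rewrite /q /indicator_ext dS adde0 lte_fin.
by move=> /(le_lt_trans ub)/limn_esup_lt; apply: filterS => k /ltW.
Qed.

(** The lower limit bounds [q d] by the real number [b], and [q] is [+oo] off [S]; hence membership
    in [S] as well as the bound. *)
Lemma epi_lower d u (tau : nat -> R) (b : R) :
  (forall k, 0 < tau k) -> tau @ \oo --> (0 : R) -> u @ \oo --> d ->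
  (\forall k \near \oo, (second_diff_quotient g x v (tau k) (u k) <= b%:E)%E) ->
  d \in S /\ dotp d (d *m M) <= b.
Proof.
move=> tau0 tauc ud ub; have [epi _] := g_epi.
have [/(_ u ud) qd _] := epi tau tau0 tauc d.
have := le_trans qd (limn_einf_le ub).
by rewrite /q /indicator_ext; case: (d \in S); rewrite ?adde0 ?addey ?lee_fin.
Qed.

(** The minorant [g_ge] bounds every second difference quotient below by [- c |u| ^ 2]; this passes
    to the limit along a recovery sequence. *)
Lemma epi_derivative_ge d : d \in S -> - c * dotp d d <= dotp d (d *m M).
Proof.
move=> dS; apply/ler_addgt0Pr => e e0.
have tau0 (k : nat) : 0 < harmonic k :> R by exact: harmonic_gt0.
have [|u ud ub] :=
  epi_recovery tau0 (@cvg_harmonic R) dS (b := dotp d (d *m M) + e).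
  by rewrite ltrDl.
have uc : (fun k => - c * dotp (u k) (u k)) @ \oo --> - c * dotp d d.
  by apply: cvgM; [exact: cvg_cst|exact: cvg_dotp].
apply: (cvgr_to_le uc).
apply: filterS ub => k; move: (harmonic k) (tau0 k) => t t0.
rewrite (second_diff_quotient_le _ _ _ gxE t0) => /(le_trans (g_ge _)).
have -> : x + t *: u k - x = t *: u k by rewrite addrC addKr.
have t2 : 0 < t ^+ 2 by rewrite exprn_gt0.
move: (u k) => w; rewrite lee_fin !dotp_lin => H.
rewrite -(ler_pM2l t2); move: H.
by move: (dotp w w) (dotp v w) (dotp d _) => a1 a2 a3; lra.
Qed.

(* [d k] minimizes [second_diff_quotient g x v (tau k) + a |. - w k|^2], so its
   limit minimizes the epi-limit [q + a |. - w|^2]. *)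
Lemma argmin_quotient_cvg (A : 'M[R]_n) (a b : R) (d w : nat -> 'rV[R]_n)
    (d' w' : 'rV[R]_n)    (tau : nat -> R) :
  0 < b ->
  (forall w, w *m A \in S /\ forall d, d \in S ->
    dotp (w *m A) (w *m A *m M) + a * dotp (w *m A - w) (w *m A - w)
      + b * dotp (d - w *m A) (d - w *m A) <=
    dotp d (d *m M) + a * dotp (d - w) (d - w)) ->
  (forall k, 0 < tau k) -> tau @ \oo --> (0 : R) ->
  d @ \oo --> d' -> w @ \oo --> w' ->
  (forall k u r, (second_diff_quotient g x v (tau k) u <= r%:E)%E ->
    (second_diff_quotient g x v (tau k) (d k) <=
      (r + a * dotp (u - w k) (u - w k)
         - a * dotp (d k - w k) (d k - w k))%:E)%E) ->
  d' = w' *m A.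
Proof.
move=> b0 AP tau0 tauc dd ww dmin.
have [sS sP] := AP w'; set s := w' *m A in sS sP *.
(* Comparison with a recovery sequence of [s] shows that [d'] is optimal up to [2 e]; the growth
   [b |d' - s| ^ 2] around the minimizer [s] then forces [d' = s]. *)
suff H e : 0 < e -> d' \in S /\
    dotp d' (d' *m M) <= dotp s (s *m M) + e + (a * dotp (s - w') (s - w')
       - a * dotp (d' - w') (d' - w') + e).
  apply/eqP; rewrite -subr_eq0 -dotpp_eq0 eq_le dotpp_ge0 andbT.
  rewrite -(pmulr_rle0 _ b0); apply/ler_addgt0Pr => e e0.
  have e2 : 0 < e / 2 by rewrite divr_gt0.
  by have [dS He] := H _ e2; have := sP _ dS; lra.
move=> e0.
have [|u us ub] := epi_recovery tau0 tauc sS (b := dotp s (s *m M) + e).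
  by rewrite ltrDl.
apply: (epi_lower tau0 tauc dd).
pose h k := a * dotp (u k - w k) (u k - w k) - a * dotp (d k - w k) (d k - w k).
have hc : h @ \oo --> a * dotp (s - w') (s - w') - a * dotp (d' - w') (d' - w').
  by apply: cvgB; (apply: cvgM; [exact: cvg_cst|apply: cvg_dotp; exact: cvgB]).
have hle : \forall k \near \oo, h k <= a * dotp (s - w') (s - w') -
    a * dotp (d' - w') (d' - w') + e.
  by apply: (cvgr_le _ hc); rewrite ltrDl.
near=> k; have /dmin/le_trans : (second_diff_quotient g x v (tau k) (u k) <=
  (dotp s (s *m M) + e)%:E)%E by near: k.
apply; rewrite lee_fin -addrA lerD2l; near: k; exact: hle.
Unshelve. all: by end_near. Qed.

End EpiDerivative.

(** * Proximal mapping *)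

Section Prox.
Context {R : realType} {n : nat}.
Variables (g : 'rV[R]_n -> \bar R).
Implicit Types (x y z v : 'rV[R]_n) (gamma : R).

(** The minimized function is finite at any point of the domain of [g], so its minimum is finite. *)
Lemma prox_fin_num gamma y z : proper_fun g -> prox gamma g y z ->
  g z \is a fin_num.
Proof.
move=> [gNy [a ga]] /(_ a) za; rewrite fin_numE -ltNye gNy/= -ltey.
rewrite lt_neqAle leey andbT; apply: contraPneq za => ->.
by rewrite addye// leye_eq; move: ga; rewrite /edom/=; case: (g a).
Qed.

Lemma proxP gamma y z (gz : R) : g z = gz%:E ->
  prox gamma g y z <-> forall z',
  ((gz + (2 * gamma)^-1 * (dotp (z - y) (z - y) - dotp (z' - y) (z' - y)))%:E
     <= g z')%E.
Proof.
move=> gzE; split=> H z'; have := H z'; rewrite gzE !sqr_enorm -leeBlDr//.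
  by apply: le_trans; rewrite lee_fin mulrBr addrA.
by move=> H'; apply: le_trans H'; rewrite lee_fin mulrBr addrA.
Qed.

(** Expand the squares in [proxP] about [x]: the cross term with [gamma v] becomes the slope [v],
    and the square becomes the curvature [1 / gamma]. *)
Lemma prox_growth gamma x v (gx : R) : 0 < gamma -> g x = gx%:E ->
  prox gamma g (x + gamma *: v) x ->
  forall z, ((gx + dotp v (z - x) - gamma^-1 / 2 * dotp (z - x) (z - x))%:E
    <= g z)%E.
Proof.
move=> gamma0 gxE /(proxP _ _ gxE) H z; apply: le_trans (H z).
rewrite lee_fin -addrA lerD2l le_eqVlt; apply/orP; left; apply/eqP.
have -> : z - (x + gamma *: v) = (z - x) - gamma *: v by rewrite opprD addrA.
have -> : x - (x + gamma *: v) = - (gamma *: v) by rewrite opprD addNKr.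
move: (z - x) => w; rewrite !dotp_lin (dotpC w v).
by field; rewrite gt_eqF.
Qed.

Section Growth.
Variables (x v : 'rV[R]_n) (gx gamma gamma' : R).
Hypothesis gamma0 : 0 < gamma.
Hypothesis gamma_lt : gamma < gamma'.
Hypothesis gxE : g x = gx%:E.
Hypothesis g_ge : forall z,
  ((gx + dotp v (z - x) - gamma'^-1 / 2 * dotp (z - x) (z - x))%:E <= g z)%E.

Lemma invr_gap : 0 < gamma^-1 - gamma'^-1.
Proof. by rewrite subr_gt0 ltf_pV2// posrE (lt_trans gamma0). Qed.

(** Adding the minorant at [z] to the optimality of [z] against [x] gives [(1 / gamma - 1 / gamma')
    / 2 |z - x| ^ 2 <= <z - x, y - (x + gamma v)> / gamma]; Cauchy-Schwarz concludes. *)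
Lemma prox_dist y z : proper_fun g -> prox gamma g y z ->
  enorm (z - x) <= 2 * gamma^-1 / (gamma^-1 - gamma'^-1) *
                   enorm (y - (x + gamma *: v)).
Proof.
move=> gproper zy; have gz := prox_fin_num gproper zy.
have := g_ge z; rewrite -(fineK gz) lee_fin.
move: (fine _) (esym (fineK gz)) => r gzE.
move/(proxP _ _ gzE)/(_ x): zy; rewrite gxE lee_fin.
have Ez : z - y = (z - x) - (y - x) by rewrite opprB addrA subrK.
have Ex : x - y = - (y - x) by rewrite opprB.
have Ey : y - (x + gamma *: v) = (y - x) - gamma *: v by rewrite opprD addrA.
rewrite Ez Ex Ey; have [->|] := eqVneq z x.
  move=> _ _; rewrite subrr; have -> : enorm (0 : 'rV[R]_n) = 0.
    by apply/eqP; rewrite enorm_eq0.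
  by rewrite !mulr_ge0 ?invr_ge0 ?enorm_ge0// ?ltW// ?invr_gap.
rewrite -subr_eq0; move: (z - x) (y - x) => a b a0.
have pa : 0 < enorm a by rewrite lt_neqAle enorm_ge0 eq_sym enorm_eq0 a0.
have := dotp_le a (b - gamma *: v); rewrite !dotp_lin (dotpC b a) (dotpC v a).
have -> : (2 * gamma)^-1 = gamma^-1 / 2 by rewrite invfM mulrC.
have E : gamma^-1 * gamma = 1 by rewrite mulVf// gt_eqF.
move=> CS H1 H2; rewrite mulrAC ler_pdivlMr ?invr_gap// -(ler_pM2r pa).
have : 0 < gamma^-1 by rewrite invr_gt0.
move: (enorm (b - _)) CS => nb CS g0.
have := ler_wpM2l (ltW g0) CS.
have -> : gamma^-1 * (dotp a b - gamma * dotp a v) =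
  gamma^-1 * dotp a b - (gamma^-1 * gamma) * dotp a v by ring.
have -> : enorm a * (gamma^-1 - gamma'^-1) * enorm a =
  (gamma^-1 - gamma'^-1) * dotp a a by rewrite -sqr_enorm; ring.
rewrite E; lra.
Qed.

Lemma prox_unique z : proper_fun g -> prox gamma g (x + gamma *: v) z -> z = x.
Proof.
move=> gp /(prox_dist gp); rewrite subrr.
have -> : enorm (0 : 'rV[R]_n) = 0 by apply/eqP; rewrite enorm_eq0.
rewrite mulr0 => z0; apply/eqP; rewrite -subr_eq0 -enorm_eq0.
by rewrite eq_le z0 enorm_ge0.
Qed.

(** In the scaled variables the cross terms of the squares with [gamma v] cancel the linear term of
    the quotient, so [d] minimizes the quotient plus [|. - w| ^ 2 / gamma]. Testing against real
    bounds [r] avoids subtracting possibly infinite quotients. *)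
Lemma prox_quotient y z tau d w : proper_fun g -> 0 < tau ->
  y = x + gamma *: v + tau *: w -> z = x + tau *: d -> prox gamma g y z ->
  forall u r, (second_diff_quotient g x v tau u <= r%:E)%E ->
    (second_diff_quotient g x v tau d <=
     (r + gamma^-1 * dotp (u - w) (u - w)
        - gamma^-1 * dotp (d - w) (d - w))%:E)%E.
Proof.
move=> gproper tau0 yE zE zy u r.
rewrite !(second_diff_quotient_le _ _ _ gxE tau0).
have gz := prox_fin_num gproper zy; move: (esym (fineK gz)).
move: (fine (g z)) => s gzE.
move/(proxP _ _ gzE)/(_ (x + tau *: u)): zy => H1 H2.
rewrite -zE gzE lee_fin; have := le_trans H1 H2; rewrite lee_fin.
have -> : z - y = tau *: (d - w) - gamma *: v.
  by rewrite zE yE; apply/rowP => i; rewrite !mxE; ring.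
have -> : x + tau *: u - y = tau *: (u - w) - gamma *: v.
  by rewrite yE; apply/rowP => i; rewrite !mxE; ring.
have -> : (2 * gamma)^-1 = gamma^-1 / 2 by rewrite invfM mulrC.
have E : gamma^-1 * gamma = 1 by rewrite mulVf// gt_eqF.
have -> : dotp v u = dotp v (u - w) + dotp v w by rewrite -dotpDr subrK.
have -> : dotp v d = dotp v (d - w) + dotp v w by rewrite -dotpDr subrK.
move: (u - w) (d - w) => a b; rewrite !dotp_lin (dotpC a v) (dotpC b v).
move: (dotp v a) (dotp v b) (dotp v w) (dotp a a) (dotp b b) (dotp v v).
move=> va vb vw aa bb vv H.
have : s + gamma^-1 / 2 * (tau ^+ 2 * (bb - aa))
   - (gamma^-1 * gamma) * (tau * (vb - va))
   <= gx + tau * (va + vw) + tau ^+ 2 / 2 * r.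
  apply: le_trans _ H; rewrite le_eqVlt; apply/orP; left; apply/eqP.
  by field; rewrite gt_eqF.
rewrite E; lra.
Qed.

End Growth.
End Prox.

Section ProxMap.
Context {R : realType} {n : nat}.
Variables (g : 'rV[R]_n -> \bar R) (gamma : R).
Hypothesis g_proper : proper_fun g.
Implicit Types (x y z : 'rV[R]_n).

Lemma lower_semicontinuous_le (u : nat -> 'rV[R]_n) z (b : nat -> R) b' :
  lower_semicontinuous g -> u @ \oo --> z -> b @ \oo --> b' ->
  (forall k, (g (u k) <= (b k)%:E)%E) -> (g z <= b'%:E)%E.
Proof.
move=> glsc uz bb' gb; rewrite leNgt; apply/negP => bz.
have [b1 bb1 b1z] : exists2 b1, b' < b1 & (b1%:E < g z)%E.
  case: (g z) bz => [r| |]//.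
    rewrite lte_fin => br; exists ((b' + r) / 2); rewrite ?lte_fin; lra.
  by exists (b' + 1); rewrite ?ltrDl// ltry.
have [V Vz Vg] := glsc z b1 b1z.
suff : b1 <= b' by rewrite leNgt bb1.
apply: (cvgr_to_ge bb'); near=> k.
have Vk : V (u k) by near: k; exact: uz.
by have := lt_le_trans (Vg _ Vk) (gb k); rewrite lte_fin => /ltW.
Unshelve. all: by end_near. Qed.

Lemma prox_closed (ys zs : nat -> 'rV[R]_n) y z : lower_semicontinuous g ->
  ys @ \oo --> y -> zs @ \oo --> z -> (forall k, prox gamma g (ys k) (zs k)) ->
  prox gamma g y z.
Proof.
move=> glsc yy zz pk z'.
have := g_proper.1 z'; case E : (g z') => [r| |]// _; last first.
  by rewrite addye// leey.
rewrite -leeBrDr// !sqr_enorm.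
pose b k := r + (2 * gamma)^-1 * dotp (z' - ys k) (z' - ys k)
              - (2 * gamma)^-1 * dotp (zs k - ys k) (zs k - ys k).
apply: (lower_semicontinuous_le (b := b) glsc zz).
  apply: cvgB; [apply: cvgD; first exact: cvg_cst|];
  (apply: cvgM; first exact: cvg_cst); apply: cvg_dotp; apply: cvgB => //;
  exact: cvg_cst.
move=> k; have := pk k z'; rewrite E !sqr_enorm -leeBrDr//.
Qed.

(** A locally bounded selection of a map with closed graph is continuous where the map is
    single-valued: values staying [e] away from [T x] would have a cluster point in the prox set at
    [Y x] other than [T x]. *)
Lemma prox_map_continuous (Y T : 'rV[R]_n -> 'rV[R]_n) x (B : R) :
  lower_semicontinuous g -> {for x, continuous Y} ->
  (\forall x' \near x, prox gamma g (Y x') (T x') /\ `|T x'| <= B) ->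
  (forall z, prox gamma g (Y x) z -> z = T x) ->
  {for x, continuous T}.
Proof.
move=> glsc Yc Tx Tu.
apply/(@cvgrPdist_lt _ _ _ (nbhs x) _ T (T x)) => e e0.
suff H : \forall x' \near x, (prox gamma g (Y x') (T x') /\ `|T x'| <= B) ->
    `|T x - T x'| < e.
  by apply: filterS2 H Tx => x' ; apply.
apply: near_seqP => u ux; apply: contrapT => nu.
have uT k : (prox gamma g (Y (u k)) (T (u k)) /\ `|T (u k)| <= B) /\
    e <= `|T x - T (u k)|.
  apply: contrapT => nk; apply: nu; exists k => Tk.
  by rewrite ltNge; apply/negP => ek; apply: nk.
have [|s sk [l Tl]] := @bounded_cvg_subseq _ _ (T \o u) B.
  by move=> k; have [[]] := uT k.
have us := cvg_subseq sk ux.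
have lE : l = T x.
  apply: Tu; apply: (prox_closed (ys := Y \o (u \o s)) glsc _ Tl).
    exact: (cvg_comp _ _ us Yc).
  by move=> k; have [[]] := uT (s k).
suff : e <= 0 by rewrite leNgt e0.
have nc : (fun k => `|T x - T (u (s k))|) @ \oo --> `|T x - l|.
  by apply: cvg_norm; apply: cvgB => //; exact: cvg_cst.
rewrite -(normr0 'rV[R]_n) -(subrr (T x)) -{2}lE.
by apply: (cvgr_to_ge nc); near=> k; have [] := uT (s k).
Unshelve. all: by end_near. Qed.

End ProxMap.

(** * First-order expansion of the proximal step *)

Section ProxMapDerivative.
Context {R : realType} {n : nat}.
Variables (g : 'rV[R]_n -> \bar R) (x v : 'rV[R]_n) (gx gamma gamma' : R).
Variables (S : {vspace 'rV[R]_n}) (M K : 'M[R]_n) (L : R).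
Variables (Y T : 'rV[R]_n -> 'rV[R]_n).
Hypothesis gamma0 : 0 < gamma.
Hypothesis gamma_lt : gamma < gamma'.
Hypothesis g_proper : proper_fun g.
Hypothesis gxE : g x = gx%:E.
Hypothesis g_ge : forall z,
  ((gx + dotp v (z - x) - gamma'^-1 / 2 * dotp (z - x) (z - x))%:E <= g z)%E.
Hypothesis g_epi : is_second_epi_derivative g x v
  (fun d => ((dotp d (d *m M))%:E + indicator_ext S d)%E).
Hypothesis Yx : Y x = x + gamma *: v.
Hypothesis Y_lip : forall x', enorm (Y x' - Y x) <= L * enorm (x' - x).
Hypothesis Y_diff : forall e : R, 0 < e -> \forall h \near (0 : 'rV[R]_n),
  enorm (Y (x + h) - Y x - h *m K) <= e * enorm h.
Hypothesis T_prox : \forall x' \near x, prox gamma g (Y x') (T x').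

(** By contradiction along a sequence [h k] tending to 0 and violating the estimate, rescaled by
    [tau k = |h k|]. The scaled steps [d] and directions [hh] are bounded, and along a subsequence
    the limit of [d] is the image under [K A] of that of [hh]; so the scaled error tends to 0 while
    exceeding [e]. *)
Lemma prox_map_frechet : exists A : 'M[R]_n, forall e : R, 0 < e ->
  \forall h \near (0 : 'rV[R]_n),
    enorm (T (x + h) - T x - h *m A) <= e * enorm h.
Proof.
have gap := invr_gap gamma0 gamma_lt.
have [|A AP] := @constrained_argmin R n S M gamma^-1 (gamma^-1 - gamma'^-1) gap.
  (* The epi-derivative has curvature at least [- 1 / gamma'] on [S], which leaves the gap as strong
     convexity modulus. *)
  by move=> d dS; have := epi_derivative_ge gxE g_epi g_ge dS; lra.
exists (K *m A) => e e0.
have Tx : T x = x.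
  have := nbhs_singleton T_prox; rewrite Yx.
  exact: (prox_unique gamma0 gamma_lt gxE g_ge g_proper).
have /near_shift0 Tp := T_prox.
suff H : \forall h \near (0 : 'rV[R]_n), prox gamma g (Y (x + h)) (T (x + h)) ->
    enorm (T (x + h) - T x - h *m (K *m A)) <= e * enorm h.
  by apply: filterS2 H Tp => h; apply.
apply: near_seqP => h h0; apply: contrapT => nh.
pose z k := T (x + h k); pose y k := Y (x + h k).
have hP k : prox gamma g (y k) (z k) /\
    e * enorm (h k) < enorm (z k - x - h k *m (K *m A)).
  apply: contrapT => nk; apply: nh; exists k => Tk.
  by rewrite leNgt; apply/negP; rewrite Tx => ek; exact: nk.
pose tau k := enorm (h k).
have tau0 k : 0 < tau k.
  rewrite lt_neqAle enorm_ge0 andbT eq_sym enorm_eq0; apply/eqP => hk.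
  have [] := hP k; rewrite /z /y hk mul0mx addr0 Tx !subrr => _.
  have /eqP-> : enorm (0 : 'rV[R]_n) == 0 by rewrite enorm_eq0.
  by rewrite mulr0 ltxx.
have tauc : tau @ \oo --> (0 : R).
  have cc : (fun k => dotp (h k) (h k)) @ \oo --> dotp 0 (0 : 'rV[R]_n).
    exact: cvg_dotp.
  have := cvg_comp _ _ cc (@sqrt_continuous R (dotp 0 0)).
  by rewrite dotp0l sqrtr0.
pose hh k := (tau k)^-1 *: h k.
pose d k := (tau k)^-1 *: (z k - x).
pose w k := (tau k)^-1 *: (y k - Y x).
have hh1 k : enorm (hh k) = 1.
  by rewrite enormZ gtr0_norm ?invr_gt0// mulVf// gt_eqF.
pose C := 2 * gamma^-1 / (gamma^-1 - gamma'^-1) * L.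
have dC k : enorm (d k) <= C.
  rewrite enormZ gtr0_norm ?invr_gt0// ler_pdivrMl//.
  apply: le_trans (prox_dist gamma0 gamma_lt gxE g_ge g_proper (hP k).1) _.
  rewrite -Yx /C [leRHS]mulrCA ler_wpM2l//.
    by rewrite mulr_ge0 ?invr_ge0 ?mulr_ge0 ?invr_ge0 ?ltW.
  by apply: le_trans (Y_lip _) _; rewrite (addrC x) addrK mulrC.
have [k|s1 s1k [h' hh']] := @bounded_cvg_subseq _ _ hh 1.
  by rewrite -(hh1 k) norm_le_enorm.
have [k|s2 s2k [d' dd']] := @bounded_cvg_subseq _ _ (d \o s1) C.
  exact: le_trans (norm_le_enorm _) (dC _).
pose s := s1 \o s2.
have sk k : (k <= s k)%N by apply: leq_trans (s2k k) (s1k _).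
have hs : (hh \o s) @ \oo --> h' by exact: (cvg_subseq s2k hh').
have ts : (tau \o s) @ \oo --> (0 : R) by exact: (cvg_subseq sk tauc).
have wK : (fun k => w k - hh k *m K) @ \oo --> (0 : 'rV[R]_n).
  apply/cvgr0Pnorm_le => e1 e10.
  have Hn : \forall k \near \oo,
    enorm (Y (x + h k) - Y x - h k *m K) <= e1 * enorm (h k).
    exact: (h0 _ (Y_diff e10)).
  apply: filterS Hn => k Hk.
  apply: le_trans (norm_le_enorm _) _.
  rewrite -scalemxAl -scalerBr enormZ gtr0_norm ?invr_gt0//.
  by rewrite ler_pdivrMl// mulrC.
have ws : (w \o s) @ \oo --> h' *m K.
  have -> : w \o s = fun k => (w (s k) - hh (s k) *m K) + hh (s k) *m K.
    by apply/funext => k; rewrite subrK.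
  rewrite -[h' *m K]add0r; apply: cvgD; first exact: (cvg_subseq sk wK).
  exact: cvg_mulmxr.
have dE : d' = h' *m K *m A.
  apply: (argmin_quotient_cvg g_epi gap AP _ ts dd' ws).
    by move=> k; exact: tau0.
  move=> k u r.
  apply: (prox_quotient gamma0 gxE g_proper (tau0 _) _ _ (hP (s k)).1).
    rewrite -Yx scalerA divff ?gt_eqF// scale1r addrC subrK//.
  by rewrite scalerA divff ?gt_eqF// scale1r addrC subrK.
have dc : (fun k => d (s k) - hh (s k) *m (K *m A)) @ \oo --> (0 : 'rV[R]_n).
  have -> : 0 = d' - h' *m (K *m A) by rewrite dE mulmxA subrr.
  exact: (cvgB dd' (cvg_mulmxr hs)).
have ec : (fun k => dotp (d (s k) - hh (s k) *m (K *m A))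
                         (d (s k) - hh (s k) *m (K *m A))) @ \oo --> (0 : R).
  by rewrite -(dotp0l (0 : 'rV[R]_n)); exact: cvg_dotp.
suff : e ^+ 2 <= 0 by rewrite leNgt exprn_gt0.
apply: (cvgr_to_ge ec); near=> k.
rewrite -sqr_enorm ler_pXn2r ?nnegrE ?enorm_ge0 ?ltW//.
rewrite -scalemxAl -scalerBr enormZ gtr0_norm ?invr_gt0//.
by rewrite ltr_pdivlMl// mulrC; exact: (hP (s k)).2.
Unshelve. all: by end_near. Qed.

End ProxMapDerivative.

(** * Norm estimates and a product rule *)

Section FrechetProducts.
Context {R : realType}.

Lemma near0_enorm_le {n} (e : R) : 0 < e ->
  \forall h \near (0 : 'rV[R]_n), enorm h <= e.
Proof.
move=> e0; apply/nbhs_ballP; exists (e / n.+1%:R) => /=; first exact: divr_gt0.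
move=> h; rewrite -ball_normE/= sub0r normrN => /ltW he.
by apply: le_trans (enorm_le_norm _) _; rewrite mulrC -ler_pdivlMr.
Qed.

Lemma enorm_mulmx_le m n (u : 'rV[R]_m) (B : 'M[R]_(m, n)) :
  enorm (u *m B) <= n.+1%:R * m%:R * `|B| * enorm u.
Proof.
apply: le_trans (enorm_le_norm _) _; rewrite -!mulrA ler_wpM2l//.
rewrite {1}/Num.Def.normr/= mx_normrE; apply/bigmax_leP; split.
  by rewrite !mulr_ge0 ?enorm_ge0.
move=> [i j] _ /=; rewrite mxE; apply: le_trans (ler_norm_sum _ _ _) _.
apply: (@le_trans _ _ (\sum_(k < m) `|B| * enorm u)).
  apply: ler_sum => k _; rewrite normrM mulrC; apply: ler_pM => //.
    rewrite [leRHS]/Num.Def.normr/= mx_normrE.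
    by apply/bigmax_geP; right => /=; exists (k, j).
  by rewrite (ord1 i); apply: le_trans (norm_coord_le _ _) (norm_le_enorm _).
by rewrite sumr_const card_ord -[leLHS]mulr_natl.
Qed.

Lemma norm_trmx_le m n (A : 'M[R]_(m, n)) : `|A^T| <= `|A|.
Proof.
rewrite {1}/Num.Def.normr/= mx_normrE; apply/bigmax_leP; split => //.
move=> [i j] _ /=; rewrite mxE [leRHS]/Num.Def.normr/= mx_normrE.
by apply/bigmax_geP; right => /=; exists (j, i).
Qed.

(* Only continuity of [W] is needed because [r] vanishes at [x]. *)
Lemma frechet_mulmx0 m n p (r : 'rV[R]_m -> 'rV[R]_n)
    (W : 'rV[R]_m -> 'M[R]_(n, p)) (x : 'rV[R]_m) (J : 'M[R]_(m, n)) :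
  r x = 0 -> {for x, continuous W} ->
  (forall e : R, 0 < e -> \forall h \near (0 : 'rV[R]_m),
     enorm (r (x + h) - r x - h *m J) <= e * enorm h) ->
  forall e : R, 0 < e -> \forall h \near (0 : 'rV[R]_m),
    enorm (r (x + h) *m W (x + h) - h *m (J *m W x)) <= e * enorm h.
Proof.
move=> r0 Wc rJ e e0.
pose N : R := p.+1%:R * n%:R.
have N0 : 0 <= N by rewrite mulr_ge0.
pose CJ : R := n.+1%:R * m%:R * `|J| + 1.
have CJ0 : 0 < CJ by rewrite ltr_wpDl// !mulr_ge0.
pose CW : R := N * (`|W x| + 1) + 1.
have CW0 : 0 < CW by rewrite ltr_wpDl// mulr_ge0// addr_ge0.
pose e1 : R := e / (2 * (N + 1) * CJ).
have e10 : 0 < e1 by rewrite divr_gt0// !mulr_gt0// ltr_wpDl.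
pose e2 : R := e / (2 * CW).
have e20 : 0 < e2 by rewrite divr_gt0// mulr_gt0.
have Wn : \forall h \near (0 : 'rV[R]_m), `|W x - W (x + h)| < Num.min e1 1.
  apply/(@near_shift0 _ _ (fun y => `|W x - W y| < Num.min e1 1)).
  apply: (@cvgrPdist_lt _ _ _ (nbhs x) _ W (W x)).1 => //.
  by rewrite lt_min e10 ltr01.
near=> h.
have Hr : enorm (r (x + h) - r x - h *m J) <= e2 * enorm h.
  by near: h; exact: rJ.
have : `|W x - W (x + h)| < Num.min e1 1 by near: h.
rewrite lt_min distrC => /andP[/ltW W1e W11]; rewrite r0 subr0 in Hr.
move: (r (x + h)) (W (x + h)) W1e W11 Hr => a W1 W1e W11 Hr.
(* Product-rule splitting: the expansion error of [r] against a bounded [W1], and the increment of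
   [W] against [h J]; each is at most [e / 2 |h|]. *)
have -> : a *m W1 - h *m (J *m W x) =
    (a - h *m J) *m W1 + (h *m J) *m (W1 - W x).
  by rewrite mulmxBl mulmxBr mulmxA addrA subrK.
have B1 : enorm ((a - h *m J) *m W1) <= e / 2 * enorm h.
  have W1b : N * `|W1| <= CW.
    rewrite /CW ler_wpDr// ler_wpM2l// -[W1](subrK (W x)) addrC.
    by apply: le_trans (ler_normD _ _) _; rewrite lerD2l ltW.
  apply: le_trans (enorm_mulmx_le _ _) _.
  apply: le_trans (ler_pM _ (enorm_ge0 _) W1b Hr) _; first by rewrite mulr_ge0.
  rewrite mulrA ler_wpM2r ?enorm_ge0// le_eqVlt; apply/orP; left; apply/eqP.
  by rewrite /e2; field; rewrite gt_eqF.
have B2 : enorm ((h *m J) *m (W1 - W x)) <= e / 2 * enorm h.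
  apply: le_trans (enorm_mulmx_le _ _) _.
  have Jb : enorm (h *m J) <= CJ * enorm h.
    apply: le_trans (enorm_mulmx_le _ _) _; rewrite ler_wpM2r ?enorm_ge0//.
    by rewrite lerDl.
  have NW : N * `|W1 - W x| <= (N + 1) * e1.
    by apply: ler_pM; rewrite ?lerDl.
  apply: le_trans (ler_pM _ (enorm_ge0 _) NW Jb) _; first by rewrite mulr_ge0.
  rewrite mulrA ler_wpM2r ?enorm_ge0// le_eqVlt; apply/orP; left; apply/eqP.
  rewrite /e1; field; rewrite (gt_eqF CJ0)/= gt_eqF// ltr_wpDl//.
apply: le_trans (enormD _ _) _; rewrite [e in leRHS]splitr mulrDl.
exact: lerD.
Unshelve. all: by end_near. Qed.

End FrechetProducts.

(** * Forward-backward envelope *)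

Section Model.
Context {R : realType} {n : nat}.
Variables (f : 'rV[R]_n -> R) (gamma L : R).
Hypothesis gamma0 : 0 < gamma.
Hypothesis L0 : 0 <= L.
Hypothesis f_lip : forall x y, enorm (grad f x - grad f y) <= L * enorm (x - y).

(** The smooth part of the function whose infimum over [z] is [fb_envelope]. *)
Definition fb_model (x z : 'rV[R]_n) : R :=
  f x + dotp (grad f x) (z - x) + (2 * gamma)^-1 * enorm (z - x) ^+ 2.

(** First-order expansion in [x] for fixed [z]. It is uniform over bounded [z] because it is to be
    used at [z = T (x + h)], which moves with [h]. *)
Lemma fb_model_eps x (B e : R) : differentiable f x ->
  differentiable (grad f) x -> 0 <= B -> 0 < e ->
  \forall h \near (0 : 'rV[R]_n), forall z, enorm (x - z) <= B ->
  `|fb_model (x + h) z - fb_model x z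
    - dotp (x - z) (h *m (gamma^-1%:M - hessian f x))| <= e * enorm h.
Proof.
move=> fx gx B0 e0.
have B1 : 0 < 1 + B by rewrite ltr_wpDr.
pose e1 := e / (2 * (1 + B)).
have e10 : 0 < e1 by rewrite divr_gt0// mulr_gt0.
pose C := L + (2 * gamma)^-1.
have C0 : 0 < C by rewrite ltr_wpDl// invr_gt0 mulr_gt0.
have e20 : 0 < e / (2 * C) by rewrite divr_gt0// mulr_gt0.
near=> h => z zB.
have : `|f (x + h) - f x - dotp (grad f x) h| <= e1 * enorm h.
  by near: h; exact: grad_eps.
have : enorm (grad f (x + h) - grad f x - h *m hessian f x) <= e1 * enorm h.
  by near: h; exact: jacobian_eps.
have : enorm h <= e / (2 * C) by near: h; exact: near0_enorm_le.
have := f_lip (x + h) x.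
have -> : x + h - x = h by rewrite addrC addKr.
rewrite /fb_model; have -> : z - (x + h) = - (x - z) - h.
  by rewrite opprB opprD addrA.
have -> : z - x = - (x - z) by rewrite opprB.
move: (f (x + h)) (f x) (grad f (x + h)) (grad f x) (hessian f x) (x - z) zB.
move=> f1 f0 G1 G0 H p pB HL Hh HG Hf.
rewrite !sqr_enorm.
(* Exact remainder: the first-order errors of [f] and of its gradient, plus two terms of second
   order in [h]. *)
have -> : f1 + dotp G1 (- p - h) + (2 * gamma)^-1 * dotp (- p - h) (- p - h) -
    (f0 + dotp G0 (- p) + (2 * gamma)^-1 * dotp (- p) (- p)) -
    dotp p (h *m (gamma^-1%:M - H)) =
    (f1 - f0 - dotp G0 h) - dotp (G1 - G0 - h *m H) p
    - dotp (G1 - G0) h + (2 * gamma)^-1 * dotp h h.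
  rewrite mulmxBr mul_mx_scalar; move: (h *m H) => hH; rewrite !dotp_lin.
  by rewrite (dotpC h p) (dotpC hH p); field; rewrite gt_eqF.
have Hp : `|dotp (G1 - G0 - h *m H) p| <= e1 * enorm h * B.
  by apply: le_trans (normr_dotp_le _ _) _; rewrite ler_pM ?enorm_ge0.
have HC : L * enorm h * enorm h + (2 * gamma)^-1 * dotp h h <= e / 2 * enorm h.
  rewrite -sqr_enorm expr2 mulrA -!mulrDl ler_wpM2r ?enorm_ge0//.
  by rewrite -/C -ler_pdivlMl// mulrC -mulrA -invfM.
have Hd : `|dotp (G1 - G0) h| <= L * enorm h * enorm h.
  by apply: le_trans (normr_dotp_le _ _) _; rewrite ler_wpM2r ?enorm_ge0.
have E1 : e1 * enorm h + e1 * enorm h * B = e / 2 * enorm h.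
  by rewrite /e1; field; rewrite gt_eqF.
have hh0 : 0 <= (2 * gamma)^-1 * dotp h h.
  by rewrite mulr_ge0 ?dotpp_ge0// invr_ge0 mulr_ge0// ltW.
have -> : e * enorm h = e / 2 * enorm h + e / 2 * enorm h.
  by rewrite -mulrDl -splitr.
move: Hf Hp HC Hd hh0 E1; set l := L * enorm h * enorm h.
move: l (e1 * enorm h * B) (e1 * enorm h) (e / 2 * enorm h) => l u w m.
move: (f1 - f0 - dotp G0 h) (dotp (G1 - G0 - h *m H) p) (dotp (G1 - G0) h).
move: ((2 * gamma)^-1 * dotp h h) => d a b c.
rewrite !ler_norml => /andP[? ?] /andP[? ?] ? /andP[? ?] ? ?.
by apply/andP; split; lra.
Unshelve. all: by end_near. Qed.

End Model.

Section Envelope.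
Context {R : realType} {n : nat}.
Variables (f : 'rV[R]_n -> R) (g : 'rV[R]_n -> \bar R) (gamma : R).
Hypothesis gamma0 : 0 < gamma.
Hypothesis g_proper : proper_fun g.

(** Completing the square: up to a term independent of [z], the model is the quadratic term of the
    prox problem at the forward point. *)
Lemma fb_modelE x z : fb_model f gamma x z =
  f x - gamma / 2 * enorm (grad f x) ^+ 2 +
  (2 * gamma)^-1 * enorm (z - (x - gamma *: grad f x)) ^+ 2.
Proof.
rewrite /fb_model; have -> : z - (x - gamma *: grad f x) =
  (z - x) + gamma *: grad f x by rewrite opprB addrA addrAC.
move: (z - x) (grad f x) (f x) => p G a.
rewrite !sqr_enorm !dotp_lin (dotpC p G).
by field; rewrite gt_eqF.
Qed.

Lemma fb_envelope_le x z :
  (fb_envelope f g gamma x <= (fb_model f gamma x z)%:E + g z)%E.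
Proof. by apply: ereal_inf_lbound; exists z. Qed.

Lemma fb_envelopeE x z (r : R) : g z = r%:E -> fb_map f g gamma x z ->
  fb_envelope f g gamma x = (fb_model f gamma x z + r)%:E.
Proof.
move=> gz Tz; apply/eqP; rewrite eq_le; apply/andP; split.
  by rewrite EFinD -gz fb_envelope_le.
apply: le_ereal_inf_tmp => _ [z' _ <-].
rewrite -/(fb_model f gamma x z') addeC -leeBlDr//.
move/(proxP _ _ gz)/(_ z') : Tz; apply: le_trans.
rewrite !fb_modelE !sqr_enorm lee_fin le_eqVlt; apply/orP; left; apply/eqP.
move: (dotp (z - _) _) (dotp (z' - _) _) (dotp (grad f x) _) (f x) => a b c d.
ring.
Qed.

Lemma fb_envelope_le_objective x :
  (fb_envelope f g gamma x <= objective f g x)%E.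
Proof.
apply: le_trans (fb_envelope_le x x) _.
have -> : fb_model f gamma x x = f x; last exact: lexx.
by rewrite /fb_model subrr dotp0r sqr_enorm dotp0l; ring.
Qed.

(** The descent inequality bounds [f z] by the model with [L] in place of [1 / gamma]; the
    difference of curvatures is the gain term. *)
Lemma objective_le_fb_envelope x z (L : R) :
  (forall y, differentiable f y) ->
  (forall x y, enorm (grad f x - grad f y) <= L * enorm (x - y)) ->
  fb_map f g gamma x z ->
  (objective f g z + ((gamma^-1 - L) / 2 * enorm (x - z) ^+ 2)%:E
     <= fb_envelope f g gamma x)%E.
Proof.
move=> fd fL Tz; have := fineK (prox_fin_num g_proper Tz).
move: (fine _) => r /esym gz.
rewrite (fb_envelopeE gz Tz) /objective gz -!EFinD lee_fin.
have := descent x (z - x) fd fL; rewrite (addrC x (z - x)) subrK /fb_model.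
rewrite -[x - z]opprB enormN.
have -> : (2 * gamma)^-1 = gamma^-1 / 2 by rewrite invfM mulrC.
move: (dotp _ _) (enorm _ ^+ 2) (f z) (f x) => a b d e; lra.
Qed.

(** Danskin-type argument: testing the infimum at [x + h] with [T x], and at [x] with [T (x + h)],
    sandwiches the increment of the envelope between two increments of the model. Their first-order
    parts differ by [<T x - T (x + h), h K>], which is small by continuity of [T]. *)
Lemma fb_envelope_grad (T : 'rV[R]_n -> 'rV[R]_n) x (L : R) : 0 <= L ->
  (forall x y, enorm (grad f x - grad f y) <= L * enorm (x - y)) ->
  differentiable f x -> differentiable (grad f) x ->
  (\forall y \near x, fb_map f g gamma y (T y)) -> {for x, continuous T} ->
  differentiable (fine \o fb_envelope f g gamma) x /\
  grad (fine \o fb_envelope f g gamma) x =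
    (gamma^-1 *: (x - T x)) *m (1%:M - gamma *: hessian f x)^T.
Proof.
move=> L0 fL fx gx Tn Tc.
pose K := gamma^-1%:M - hessian f x.
have -> : (gamma^-1 *: (x - T x)) *m (1%:M - gamma *: hessian f x)^T =
    (x - T x) *m K^T.
  rewrite -scalemxAl scalemxAr -linearZ/= scalerBr scalerA mulVf ?gt_eqF//.
  by rewrite scale1r scalemx1.
apply: (@grad_unique _ _ (fine \o fb_envelope f g gamma) x) => e e0.
have Txm := nbhs_singleton Tn.
move/near_shift0 : Tn => Tn.
pose N : R := n.+1%:R * n%:R * `|K| + 1.
have N0 : 0 < N by rewrite ltr_wpDl// !mulr_ge0.
have e2 : 0 < e / 2 by rewrite divr_gt0.
pose e1 := e / (2 * N * n.+1%:R).
have e10 : 0 < e1 by rewrite divr_gt0// !mulr_gt0.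
(* Large enough to bound the distances from [x] to both [T x] and [T (x + h)]. *)
pose B := enorm (x - T x) + 1 + n.+1%:R * e1.
have Ne1 : 0 <= n.+1%:R * e1 by rewrite mulr_ge0// ltW.
have B0 : 0 <= B by rewrite /B addr_ge0// addr_ge0// enorm_ge0.
near=> h.
have Tm : fb_map f g gamma (x + h) (T (x + h)) by near: h.
have h1 : enorm h <= 1 by near: h; exact: near0_enorm_le.
have : `|T x - T (x + h)| <= e1.
  near: h; apply/(@near_shift0 _ _ (fun y => `|T x - T y| <= e1)).
  by apply: (@cvgrPdist_le _ _ _ (nbhs x) _ T (T x)).1.
have : forall z, enorm (x - z) <= B ->
    `|fb_model f gamma (x + h) z - fb_model f gamma x z
      - dotp (x - z) (h *m K)| <= e / 2 * enorm h.
  by near: h; exact: (fb_model_eps gamma0 L0 fL).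
have := fineK (prox_fin_num g_proper Txm); move: (fine _) => rx /esym gx0.
have := fineK (prox_fin_num g_proper Tm); move: (fine _) => rh /esym gh.
have := fb_envelope_le (x + h) (T x); have := fb_envelope_le x (T (x + h)).
rewrite (fb_envelopeE gx0 Txm) (fb_envelopeE gh Tm).
rewrite /comp (fb_envelopeE gx0 Txm) (fb_envelopeE gh Tm) /=.
rewrite gx0 gh -!EFinD !lee_fin dotp_mull trmxK.
move: (fb_model f gamma (x + h)) (fb_model f gamma x) => m1 m0.
move: (T (x + h)) {Tm gh} => Th H1 H2 Hm HT.
have ThT : enorm (T x - Th) <= n.+1%:R * e1.
  by apply: le_trans (enorm_le_norm _) _; rewrite ler_wpM2l.
have := Hm (T x) _; have := Hm Th _.
have -> : x - Th = (x - T x) + (T x - Th) by rewrite addrA subrK.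
rewrite dotpDl => /(_ _)/= Hh Hx.
have {}Hx : `|m1 (T x) - m0 (T x) - dotp (x - T x) (h *m K)| <= e / 2 * enorm h.
  by apply: Hx; rewrite /B -addrA lerDl addr_ge0.
have {}Hh : `|m1 Th - m0 Th -
     (dotp (x - T x) (h *m K) + dotp (T x - Th) (h *m K))|
   <= e / 2 * enorm h.
  apply: Hh; apply: le_trans (enormD _ _) _; rewrite /B -addrA lerD2l.
  by rewrite ler_wpDl.
have : `|dotp (T x - Th) (h *m K)| <= e / 2 * enorm h.
  apply: le_trans (normr_dotp_le _ _) _.
  have hK : enorm (h *m K) <= N * enorm h.
    apply: le_trans (enorm_mulmx_le _ _) _; rewrite ler_wpM2r ?enorm_ge0//.
    by rewrite lerDl.
  apply: le_trans (ler_pM (enorm_ge0 _) (enorm_ge0 _) ThT hK) _.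
  rewrite mulrA ler_wpM2r ?enorm_ge0// le_eqVlt; apply/orP; left; apply/eqP.
  by rewrite /e1; field; rewrite (gt_eqF N0)/= ?nat1r ?natr1 pnatr_eq0.
move: H1 H2 Hx Hh; move: (dotp (x - T x) _) (dotp (T x - Th) _) => a b.
move: (m1 (T x)) (m0 (T x)) (m1 Th) (m0 Th) (enorm h) => c1 c2 c3 c4 c5; clear.
move=> H1 H2; rewrite !ler_norml => /andP[? ?] /andP[? ?] /andP[? ?].
apply/andP; split; lra.
Unshelve. all: by end_near. Qed.

End Envelope.

(** * Second-order optimality conditions *)

Section SecondOrderConditions.
Context {R : realType}.

Lemma near0_scale {V : normedModType R} (P : set V) (h : V) :
  (\forall u \near (0 : V), P u) -> exists2 t : R, 0 < t & P (t *: h).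
Proof.
move=> /nbhs_ballP[e /= e0 eP].
have h0 : 0 < `|h| + 1 by rewrite ltr_wpDl.
exists (e / (`|h| + 1)); first exact: divr_gt0.
apply: eP; rewrite -ball_normE/= sub0r normrN normrZ gtr0_norm ?divr_gt0//.
by rewrite mulrAC ltr_pdivrMr// ltr_pM2l// ltrDl.
Qed.

(** Comparing [F (x + t h) - F x] with its linear part at one small [t] and dividing by [t] gives
    the bound up to an arbitrary [e]. *)
Lemma jacobian_lipschitz m n (F : 'rV[R]_m -> 'rV[R]_n) x (L : R) :
  differentiable F x ->
  (forall y z, enorm (F y - F z) <= L * enorm (y - z)) ->
  forall h, enorm (h *m 'J F x) <= L * enorm h.
Proof.
move=> Fx FL h; have h1 : 0 < enorm h + 1 by rewrite ltr_wpDl ?enorm_ge0.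
apply/ler_addgt0Pr => e e0; have e1 : 0 < e / (enorm h + 1) by exact: divr_gt0.
have [t t0] := near0_scale h (jacobian_eps Fx e1).
have := FL (x + t *: h) x.
have -> : x + t *: h - x = t *: h by rewrite addrC addKr.
move: (F (x + _) - F x) ('J F x) => d J Hd Hj.
have := enormD d (- (d - (t *: h) *m J)); rewrite enormN opprB addrC subrK.
move=> /le_trans/(_ (lerD Hd Hj)).
rewrite -scalemxAl !enormZ gtr0_norm// -mulrDl mulrCA ler_pM2l// => /le_trans.
apply; rewrite mulrDl lerD2l mulrAC ler_pdivrMr// ler_pM2l//.
by rewrite lerDl.
Qed.

Context {n : nat}.
Implicit Types (A : 'M[R]_n) (f : 'rV[R]_n -> R) (x h : 'rV[R]_n).

Lemma posdef_unitmx A : posdef A -> A \in unitmx.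
Proof.
move=> [_ Apos]; apply: inj_unitmx => u uA; apply/eqP.
by apply: contraT => /Apos; rewrite uA dotp0r ltxx.
Qed.

(* A vector annihilating a nonnegative symmetric form minimizes it, so it lies
   in the kernel. *)
Lemma unitmx_posdef A : A^T = A -> A \in unitmx ->
  (forall h, 0 <= dotp h (h *m A)) -> posdef A.
Proof.
move=> At Au A0; split=> // d d0; rewrite lt_neqAle A0 andbT eq_sym.
apply/negP => /eqP dAd; move/negP: d0; apply.
have dA : d *m A = 0.
  apply: dotp_inj => e; rewrite dotp0r; apply/eqP; apply: contraT => eA.
  pose b := dotp e (d *m A); pose c := dotp e (e *m A).
  have bE : dotp d (e *m A) = b by rewrite dotp_mulr At dotpC.
  have H t : 0 <= 2 * t * b + t ^+ 2 * c.
    have := A0 (d + t *: e).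
    rewrite mulmxDl -scalemxAl !dotp_lin dAd bE -/b -/c.
    by move/le_trans; apply; rewrite le_eqVlt; apply/orP; left; apply/eqP; ring.
  have c1 : 0 < c + 1 by rewrite ltr_wpDl// A0.
  (* The form is negative at this [t] unless [b = 0]; the [+ 1] keeps the denominator positive when
     [c = 0]. *)
  have := H (- b / (c + 1)).
  have -> : 2 * (- b / (c + 1)) * b + (- b / (c + 1)) ^+ 2 * c =
    - (b ^+ 2 * (c + 2) / (c + 1) ^+ 2) by field; rewrite gt_eqF.
  rewrite oppr_ge0 leNgt divr_gt0//; last by rewrite exprn_gt0.
  rewrite mulr_gt0//; last by rewrite ltr_wpDl// A0.
  by rewrite lt_neqAle sqr_ge0 andbT eq_sym sqrf_eq0.
by rewrite -(mulmxK Au d) dA mul0mx.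
Qed.

(** Compactness of the unit sphere: otherwise unit vectors with form at most [1 / (k + 1)] would
    accumulate at a unit vector where the form is nonpositive. *)
Lemma posdef_coercive A : posdef A ->
  exists2 a : R, 0 < a & forall h, a * dotp h h <= dotp h (h *m A).
Proof.
move=> [_ Apos]; apply: contrapT => nA.
have /choice[u uP] (k : nat) : exists u : 'rV[R]_n,
    enorm u = 1 /\ dotp u (u *m A) <= k.+1%:R^-1.
  apply: contrapT => nu; apply: nA; exists k.+1%:R^-1 => // h.
  have [->|h0] := eqVneq h 0; first by rewrite !dotp0l mulr0.
  rewrite leNgt; apply/negP => hk; apply: nu.
  have eh : 0 < enorm h by rewrite lt_neqAle enorm_ge0 eq_sym enorm_eq0 h0.
  exists ((enorm h)^-1 *: h); split.
    by rewrite enormZ gtr0_norm ?invr_gt0// mulVf// gt_eqF.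
  rewrite -scalemxAl dotpZl dotpZr ler_pdivrMl// ler_pdivrMl//.
  by rewrite mulrA -expr2 sqr_enorm mulrC ltW.
have [k|s sk [l ul]] := @bounded_cvg_subseq _ _ u 1.
  by have [<- _] := uP k; exact: norm_le_enorm.
have l1 : dotp l l = 1.
  have lc : (fun k => dotp (u (s k)) (u (s k))) @ \oo --> dotp l l.
    exact: cvg_dotp.
  have E : (fun k => dotp (u (s k)) (u (s k))) = cst 1.
    by apply/funext => k; rewrite -sqr_enorm (uP (s k)).1 expr1n.
  by rewrite E in lc; apply: (cvg_unique _ lc (cvg_cst _)).
have l0 : l != 0 by rewrite -dotpp_eq0 l1 oner_eq0.
have := Apos _ l0; rewrite ltNge => /negP; apply.
have lc : (fun k => dotp (u (s k)) (u (s k) *m A)) @ \oo --> dotp l (l *m A).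
  by apply: cvg_dotp => //; exact: cvg_mulmxr.
apply/ler_addgt0Pr => _/posnumP[e]; rewrite add0r.
apply: (cvgr_to_le lc); near=> k.
apply: le_trans (uP (s k)).2 _.
apply: (@le_trans _ _ k.+1%:R^-1).
  by rewrite lef_pV2 ?posrE// ler_nat ltnS.
by apply: ltW; near: k; exact: near_infty_natSinv_lt.
Unshelve. all: by end_near. Qed.

(** Compare the growth with the Taylor expansion at [x + t h] and divide by [t ^ 2]; the factor 2
    undoes the [1 / 2] in Taylor's formula. With [c = 0] this is the second-order necessary
    condition, with [c > 0] it gives definiteness. *)
Lemma hessian_ge f x (c : R) :
  (\forall y \near x, differentiable f y) -> differentiable (grad f) x ->
  grad f x = 0 ->
  (\forall y \near x, f x + c * enorm (y - x) ^+ 2 <= f y) ->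
  forall h, 2 * c * dotp h h <= dotp h (h *m hessian f x).
Proof.
move=> fd gd g0 /near_shift0 fc h.
apply/ler_addgt0Pr => e e0.
have h1 : 0 < 2 * (dotp h h + 1) by rewrite mulr_gt0// ltr_wpDl ?dotpp_ge0.
have e1 : 0 < e / (2 * (dotp h h + 1)) by exact: divr_gt0.
have Hn : \forall u \near (0 : 'rV[R]_n), f x + c * enorm u ^+ 2 <= f (x + u) /\
    `|f (x + u) - f x - dotp (grad f x) u - dotp (u *m hessian f x) u / 2|
      <= e / (2 * (dotp h h + 1)) * enorm u ^+ 2.
  near=> u; split; last by near: u; exact: taylor2.
  have : f x + c * enorm (x + u - x) ^+ 2 <= f (x + u) by near: u.
  by rewrite [X in enorm X]addrC addKr.
have [t t0 []] := near0_scale h Hn.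
rewrite g0 dotp0l subr0; move: (f (x + _)) (f x) (hessian f x) => a b H.
rewrite !sqr_enorm -scalemxAl !dotp_lin (dotpC (h *m H)).
move: (dotp h (h *m H)) => q; set d := dotp h h in h1 e1 *.
have -> : e / (2 * (d + 1)) * (t * (t * d)) = t ^+ 2 * (e / (2 * (d + 1)) * d).
  by ring.
have t2 : 0 < t ^+ 2 by rewrite exprn_gt0.
have d0 : 0 <= d by exact: dotpp_ge0.
have : e / (2 * (d + 1)) * d <= e / 2.
  rewrite invfM mulrA -[leRHS]mulr1 -mulrA ler_pM2l ?divr_gt0//.
  by rewrite ler_pdivrMl ?mulr1 ?lerDl// ltr_wpDl.
move: (e / _ * d) => w we H1; rewrite ler_norml => /andP[_ H2].
rewrite -(ler_pM2l t2).
have := ler_wpM2l (ltW t2) we.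
have -> : t ^+ 2 * (2 * c * d) = 2 * (c * (t * (t * d))) by ring.
have -> : t ^+ 2 * (q + e) = t * (t * q) + t ^+ 2 * e by ring.
lra.
Unshelve. all: by end_near. Qed.

(** Coercivity makes the Taylor quadratic at least [a / 2 |h| ^ 2]; a remainder tolerance of [a / 4]
    leaves growth with constant [a / 4]. *)
Lemma posdef_hessian_growth f x :
  (\forall y \near x, differentiable f y) -> differentiable (grad f) x ->
  grad f x = 0 -> posdef (hessian f x) ->
  exists2 c : R, 0 < c & \forall y \near x, f x + c * enorm (y - x) ^+ 2 <= f y.
Proof.
move=> fd gd g0 /posdef_coercive[a a0 Ha].
have a4 : 0 < a / 4 by rewrite divr_gt0.
exists (a / 4) => //; apply/near_shift0.
apply: filterS (taylor2 fd gd a4) => h.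
have -> : x + h - x = h by rewrite addrC addKr.
have := Ha h; rewrite g0 dotp0l subr0 !sqr_enorm (dotpC (h *m _)).
move: (f (x + _)) (f x) (dotp h (h *m _)) (dotp h h) => p q r s Hr.
rewrite ler_norml => /andP[? ?]; lra.
Qed.

End SecondOrderConditions.

(** Local minimality is growth with constant 0, so the growth lemmas cover both kinds of minimum. *)
Lemma growth0_local_min {R : realType} {n : nat} (h : 'rV[R]_n -> \bar R) x :
  local_min h x <->
  \forall y \near x, (h x + (0 * enorm (y - x) ^+ 2)%:E <= h y)%E.
Proof. by split; apply: filterS => y; rewrite mul0r adde0. Qed.

Lemma strong_local_minW {R : realType} {n : nat} (h : 'rV[R]_n -> \bar R) x :
  strong_local_min h x -> local_min h x.
Proof.
move=> [c c0]; apply: filterS => y; apply: le_trans.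
by rewrite leeDl// lee_fin mulr_ge0 ?sqr_ge0// ltW.
Qed.

(** * Equivalences at a point fixed by a larger step *)

Section ForwardBackwardEnvelope.
Context {R : realType} {n : nat}.
Variables (f : 'rV[R]_n -> R) (g : 'rV[R]_n -> \bar R) (xs : 'rV[R]_n).
Variables (gamma gamma' L gx : R) (S : {vspace 'rV[R]_n}) (M : 'M[R]_n).
Hypothesis f_diff : forall x, differentiable f x.
Hypothesis L0 : 0 <= L.
Hypothesis f_lip : forall x y, enorm (grad f x - grad f y) <= L * enorm (x - y).
Hypothesis g_proper : proper_fun g.
Hypothesis g_lsc : lower_semicontinuous g.
Hypothesis gamma0 : 0 < gamma.
Hypothesis gamma_lt : gamma < gamma'.
Hypothesis gammaL : gamma * L < 1.
Hypothesis gxE : g xs = gx%:E.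
Hypothesis xs_fix : fb_map f g gamma' xs xs.
Hypothesis f_C2 : \forall x \near xs,
  differentiable (grad f) x /\ {for x, continuous (hessian f)}.
Hypothesis g_epi : is_second_epi_derivative g xs (- grad f xs)
  (fun d => ((dotp d (d *m M))%:E + indicator_ext S d)%E).
Hypothesis R_single : single_valued_around (fb_residual f g gamma) xs.

Let Rg := value_of (fb_residual f g gamma).
(** Recovered from the chosen residual, hence total; near [xs] it is the unique forward-backward
    point, by [near_fb_map]. *)
Let T (x : 'rV[R]_n) := x - gamma *: Rg x.
Let Y (x : 'rV[R]_n) := x - gamma *: grad f x.
Let W (x : 'rV[R]_n) := (1%:M - gamma *: hessian f x)^T.
Let phi := fine \o fb_envelope f g gamma.

Lemma residualE x : Rg x = gamma^-1 *: (x - T x).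
Proof.
by rewrite /T opprB addrC subrK scalerA mulVf ?gt_eqF// scale1r.
Qed.

Lemma near_fb_map : \forall x \near xs,
  fb_map f g gamma x (T x) /\ forall z, fb_map f g gamma x z -> z = T x.
Proof.
apply: filterS R_single => x [y xy].
have Rx : Rg x = y.
  rewrite /Rg /value_of xy.
  by have := @xgetPex _ 0 [set y] (ex_intro _ y erefl).
have [z zx zy] : fb_residual f g gamma x y by rewrite xy.
have Tz : T x = z.
  by rewrite /T Rx -zy scalerA divff ?gt_eqF// scale1r opprB addrC subrK.
split=> [|z' z'x]; first by rewrite Tz.
have : fb_residual f g gamma x (gamma^-1 *: (x - z')) by exists z'.
rewrite xy /= => z'y; rewrite /T Rx -z'y scalerA divff ?gt_eqF// scale1r.
by rewrite opprB addrC subrK.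
Qed.

(** The fixed-point property is used for the larger step [gamma'], so the curvature [1 / gamma'] is
    strictly below [1 / gamma]. *)
Lemma growth_xs z :
  ((gx + dotp (- grad f xs) (z - xs)
       - gamma'^-1 / 2 * dotp (z - xs) (z - xs))%:E <= g z)%E.
Proof.
apply: prox_growth gxE _ z; first exact: lt_trans gamma_lt.
by move: xs_fix; rewrite /fb_map scalerN.
Qed.

Lemma forward_xs : Y xs = xs + gamma *: (- grad f xs).
Proof. by rewrite /Y scalerN. Qed.

Lemma forward_lip x y : enorm (Y x - Y y) <= (1 + gamma * L) * enorm (x - y).
Proof.
have -> : Y x - Y y = (x - y) - gamma *: (grad f x - grad f y).
  rewrite /Y; move: (grad f x) (grad f y) => a b.
  by apply/rowP => i; rewrite !mxE; ring.
apply: le_trans (enormD _ _) _; rewrite enormN enormZ gtr0_norm// mulrDl mul1r.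
by rewrite lerD2l -mulrA ler_pM2l.
Qed.

Lemma fb_map_xs : T xs = xs.
Proof.
have [Txs _] := nbhs_singleton near_fb_map.
apply: (prox_unique gamma0 gamma_lt gxE growth_xs g_proper).
by rewrite -forward_xs.
Qed.

(** The gradient formula of the envelope requires continuity at all points near [xs]. Boundedness
    comes from [prox_dist], and single-valuedness then gives continuity. *)
Lemma fb_map_near_continuous : \forall x \near xs, {for x, continuous T}.
Proof.
have := nbhs_interior near_fb_map; apply: filterS2 f_C2 => x [gdx _].
rewrite /interior/= => Tn.
have [_ Tu] := nbhs_singleton Tn.
pose C := 2 * gamma^-1 / (gamma^-1 - gamma'^-1) *
  ((1 + gamma * L) * (enorm (x - xs) + 1)) + `|xs|.
apply: (@prox_map_continuous _ _ g gamma g_proper Y T x C g_lsc _ _ Tu).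
  have Yx : differentiable Y x.
    by apply: differentiableB => //; exact: differentiableZ.
  exact: differentiable_continuous.
have n1 : \forall y \near x, enorm (y - x) <= 1.
  apply/near_shift0; apply: filterS (near0_enorm_le ltr01) => h.
  by have -> : x + h - x = h by rewrite addrC addKr.
apply: filterS2 n1 Tn => y yx [Ty _]; split => //.
rewrite -[T y](subrK xs); apply: le_trans (ler_normD _ _) _.
rewrite lerD2r; apply: le_trans (norm_le_enorm _) _.
apply: le_trans (prox_dist gamma0 gamma_lt gxE growth_xs g_proper Ty) _.
rewrite ler_wpM2l//.
  by rewrite !mulr_ge0 ?invr_ge0 ?(ltW (invr_gap gamma0 gamma_lt)) ?ltW.
rewrite -forward_xs; apply: le_trans (forward_lip _ _) _.
apply: ler_wpM2l; first by rewrite addr_ge0// mulr_ge0// ltW.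
have -> : y - xs = (x - xs) + (y - x) by apply/rowP => i; rewrite !mxE; ring.
by apply: le_trans (enormD _ _) _; rewrite lerD2l.
Qed.

Lemma residual_frechet : exists J : 'M[R]_n, forall e : R, 0 < e ->
  \forall h \near (0 : 'rV[R]_n),
    enorm (Rg (xs + h) - Rg xs - h *m J) <= e * enorm h.
Proof.
have [gdx _] := nbhs_singleton f_C2.
have [|||A HA] := @prox_map_frechet R n g xs (- grad f xs) gx gamma gamma' S M
  (1%:M - gamma *: hessian f xs) (1 + gamma * L) Y T gamma0 gamma_lt g_proper
  gxE growth_xs g_epi forward_xs.
- by move=> x; exact: forward_lip.
- move=> e e0; have eg : 0 < e / gamma by exact: divr_gt0.
  apply: filterS (jacobian_eps gdx eg) => h.
  rewrite -/(hessian f xs) /Y mulmxBr mulmx1 -scalemxAr.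
  move: (grad f (xs + h)) (grad f xs) (h *m _) => a b c.
  have -> : xs + h - gamma *: a - (xs - gamma *: b) - (h - gamma *: c) =
    - gamma *: (a - b - c) by apply/rowP => i; rewrite !mxE; ring.
  rewrite enormZ normrN gtr0_norm// => H.
  by rewrite -ler_pdivlMl// mulrA (mulrC gamma^-1).
- by apply: filterS near_fb_map => x [].
exists (gamma^-1 *: (1%:M - A)) => e e0.
have eg : 0 < e * gamma by exact: mulr_gt0.
apply: filterS (HA _ eg) => h; rewrite !residualE.
rewrite -scalemxAr mulmxBr mulmx1 -scalerBr.
move: (T (xs + h)) (T xs) (h *m A) => a b c.
have -> : gamma^-1 *: (xs + h - a - (xs - b)) - gamma^-1 *: (h - c) =
   - gamma^-1 *: (a - b - c) by apply/rowP => i; rewrite !mxE; ring.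
rewrite enormZ normrN gtr0_norm ?invr_gt0// => H.
by rewrite ler_pdivrMl// mulrA (mulrC gamma).
Qed.

Lemma residual_jacobian : differentiable Rg xs.
Proof. by have [J /jacobian_unique[]] := residual_frechet. Qed.

Lemma residual_xs : Rg xs = 0.
Proof. by rewrite residualE fb_map_xs subrr scaler0. Qed.

Lemma fb_envelope_near_grad : \forall x \near xs,
  differentiable phi x /\ grad phi x = Rg x *m W x.
Proof.
have := nbhs_interior near_fb_map.
apply: filterS3 f_C2 fb_map_near_continuous => x [gdx _] Tc.
rewrite /interior/= => Tn; rewrite residualE.
apply: (fb_envelope_grad gamma0 g_proper L0 f_lip (f_diff x) gdx _ Tc).
by apply: filterS Tn => y [].
Qed.

Lemma grad_fb_envelope_xs : grad phi xs = 0.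
Proof.
have [_ ->] := nbhs_singleton fb_envelope_near_grad.
by rewrite residual_xs mul0mx.
Qed.

(** Near [xs] the gradient is [Rg x W x], and [Rg xs = 0], so the derivative of the product keeps a
    single term. *)
Lemma grad_fb_envelope_frechet :
  differentiable (grad phi) xs /\ hessian phi xs = 'J Rg xs *m W xs.
Proof.
have [_ Hc] := nbhs_singleton f_C2.
have Wc : {for xs, continuous W}.
  apply/(@cvgrPdist_lt _ _ _ (nbhs xs) _ W (W xs)) => e e0.
  have eg : 0 < e / gamma by exact: divr_gt0.
  have Hn : \forall y \near xs, `|hessian f xs - hessian f y| < e / gamma.
    exact: (@cvgrPdist_lt _ _ _ (nbhs xs) _ _ _).1 Hc _ eg.
  apply: filterS Hn => y; rewrite /W.
  move: (hessian f xs) (hessian f y) => H1 H2 H12.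
  rewrite -linearB/=; apply: le_lt_trans (norm_trmx_le _) _.
  have -> : 1%:M - gamma *: H1 - (1%:M - gamma *: H2) = - gamma *: (H1 - H2).
    by apply/matrixP => i j; rewrite !mxE; ring.
  by rewrite normrZ normrN gtr0_norm// mulrC -ltr_pdivlMr.
apply: jacobian_unique => e e0.
have := frechet_mulmx0 residual_xs Wc
  (fun e => @jacobian_eps _ _ _ _ _ e residual_jacobian) e0.
have /near_shift0 := fb_envelope_near_grad.
by apply: filterS2 => h [_ ->]; rewrite grad_fb_envelope_xs subr0.
Qed.

(** If [u W = 0] with [u] nonzero, then [|u| ^ 2 = gamma <u, u H> <= gamma L |u| ^ 2 < |u| ^ 2]. *)
Lemma forward_unitmx : W xs \in unitmx.
Proof.
apply: inj_unitmx => u uW; apply/eqP; apply: contraT => u0.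
have : dotp (u *m W xs) u = 0 by rewrite uW dotp0l.
rewrite dotp_mull /W trmxK mulmxBr mulmx1 -scalemxAr dotpDr dotpNr dotpZr.
have [gdx _] := nbhs_singleton f_C2.
have := jacobian_lipschitz gdx f_lip u; rewrite -/(hessian f xs) => Hu.
have := le_trans (dotp_le u (u *m hessian f xs)) (ler_wpM2l (enorm_ge0 u) Hu).
rewrite mulrCA -expr2 sqr_enorm.
have : 0 < dotp u u by rewrite dotpp_gt0.
move: (dotp u u) (dotp u (u *m _)) => a b a0 bL E.
have : gamma * b <= (gamma * L) * a by rewrite -mulrA ler_pM2l.
have : gamma * L * a < 1 * a by rewrite ltr_pM2r.
lra.
Qed.

Lemma fb_envelope_hessian_sym : (hessian phi xs)^T = hessian phi xs.
Proof.
apply: hessian_sym; last by have [] := grad_fb_envelope_frechet.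
by apply: filterS fb_envelope_near_grad => x [].
Qed.

Lemma unitmx_hessian_residual :
  (hessian phi xs \in unitmx) = ('J Rg xs \in unitmx).
Proof.
have [_ ->] := grad_fb_envelope_frechet.
by rewrite unitmx_mul forward_unitmx andbT.
Qed.

Lemma near_fb_envelope_fin : \forall x \near xs,
  fb_envelope f g gamma x = (phi x)%:E.
Proof.
apply: filterS near_fb_map => x [Tx _].
have := fineK (prox_fin_num g_proper Tx); move: (fine _) => r /esym gr.
by rewrite /phi /comp (fb_envelopeE gamma0 gr Tx).
Qed.

Lemma fb_envelope_xs : fb_envelope f g gamma xs = objective f g xs.
Proof.
have [+ _] := nbhs_singleton near_fb_map; rewrite fb_map_xs => Txs.
rewrite (fb_envelopeE gamma0 gxE Txs) /objective gxE -EFinD; congr (_%:E).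
by rewrite /fb_model subrr dotp0r sqr_enorm dotp0l; ring.
Qed.

(** The envelope lies below the objective and agrees with it at [xs]. *)
Lemma local_growth_envelope_objective (c : R) :
  (\forall y \near xs, (fb_envelope f g gamma xs + (c * enorm (y - xs) ^+ 2)%:E
     <= fb_envelope f g gamma y)%E) ->
  \forall y \near xs, (objective f g xs + (c * enorm (y - xs) ^+ 2)%:E
     <= objective f g y)%E.
Proof.
rewrite fb_envelope_xs; apply: filterS => y /le_trans; apply.
exact: fb_envelope_le_objective.
Qed.

(* With [z = T y]: [phi_gamma y >= phi z + k |y - z|^2 >=
   phi xs + c |z - xs|^2 + k |y - z|^2], and
   [|y - xs|^2 <= 2 |y - z|^2 + 2 |z - xs|^2]. *)
Lemma local_growth_objective_envelope (c : R) : 0 <= c ->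
  (\forall y \near xs, (objective f g xs + (c * enorm (y - xs) ^+ 2)%:E
     <= objective f g y)%E) ->
  \forall y \near xs,
    (fb_envelope f g gamma xs +
      (Num.min c ((gamma^-1 - L) / 2) / 2 * enorm (y - xs) ^+ 2)%:E
     <= fb_envelope f g gamma y)%E.
Proof.
move=> c0 cg.
(* As [T y] tends to [xs], the growth of the objective can be applied at [T y]. *)
have Tc : T @ xs --> T xs := nbhs_singleton fb_map_near_continuous.
rewrite fb_map_xs in Tc.
have cT : \forall y \near xs, (objective f g xs + (c * enorm (T y - xs) ^+ 2)%:E
     <= objective f g (T y))%E.
  exact: (Tc _ cg).
apply: filterS2 near_fb_map cT => y [Ty _] cTy.
apply: le_trans (objective_le_fb_envelope gamma0 g_proper f_diff f_lip Ty).
rewrite fb_envelope_xs; set k := (gamma^-1 - L) / 2.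
apply: le_trans (leeD2r _ cTy).
rewrite /objective gxE -!EFinD lee_fin -[leRHS]addrA lerD2l.
have k0 : 0 <= k.
  by rewrite divr_ge0// subr_ge0 -(ler_pM2l gamma0) mulfV ?gt_eqF// ltW.
set m := Num.min c k.
have mc : m <= c by rewrite ge_min lexx.
have mk : m <= k by rewrite ge_min lexx orbT.
have m0 : 0 <= m by rewrite le_min c0.
have -> : y - xs = (y - T y) + (T y - xs) by rewrite addrA subrK.
move: (y - T y) (T y - xs) => a b; rewrite !sqr_enorm.
have par : dotp (a + b) (a + b) <= 2 * dotp a a + 2 * dotp b b.
  by have := dotpp_ge0 (a - b); rewrite !dotp_lin (dotpC b a); lra.
have := ler_wpM2r (dotpp_ge0 b) mc; have := ler_wpM2r (dotpp_ge0 a) mk.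
have := ler_wpM2l m0 par; lra.
Qed.

Lemma local_growth_envelope_fin (c : R) :
  (\forall y \near xs, (fb_envelope f g gamma xs + (c * enorm (y - xs) ^+ 2)%:E
     <= fb_envelope f g gamma y)%E) <->
  \forall y \near xs, phi xs + c * enorm (y - xs) ^+ 2 <= phi y.
Proof.
have xsE := nbhs_singleton near_fb_envelope_fin.
by split; apply: filterS2 near_fb_envelope_fin => y yE;
  rewrite yE xsE -EFinD lee_fin.
Qed.

Lemma local_growth_hessian (c : R) :
  (\forall y \near xs, (fb_envelope f g gamma xs + (c * enorm (y - xs) ^+ 2)%:E
     <= fb_envelope f g gamma y)%E) ->
  forall h, 2 * c * dotp h h <= dotp h (h *m hessian phi xs).
Proof.
move=> /local_growth_envelope_fin; apply: hessian_ge.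
- by apply: filterS fb_envelope_near_grad => x [].
- by have [] := grad_fb_envelope_frechet.
- exact: grad_fb_envelope_xs.
Qed.

Lemma posdef_strong_local_min :
  posdef (hessian phi xs) -> strong_local_min (fb_envelope f g gamma) xs.
Proof.
move=> /posdef_hessian_growth[||| c c0 /local_growth_envelope_fin]; last
  by exists c.
- by apply: filterS fb_envelope_near_grad => x [].
- by have [] := grad_fb_envelope_frechet.
- exact: grad_fb_envelope_xs.
Qed.

Lemma strong_local_min_objective_envelope :
  strong_local_min (objective f g) xs <->
  strong_local_min (fb_envelope f g gamma) xs.
Proof.
split=> -[c c0 cg].
  exists (Num.min c ((gamma^-1 - L) / 2) / 2); last first.
    by apply: local_growth_objective_envelope => //; exact: ltW.
  rewrite divr_gt0// lt_min c0 divr_gt0// subr_gt0.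
  by rewrite -(ltr_pM2l gamma0) mulfV ?gt_eqF.
by exists c => //; exact: local_growth_envelope_objective.
Qed.

Lemma local_min_objective_envelope :
  local_min (objective f g) xs <-> local_min (fb_envelope f g gamma) xs.
Proof.
split=> /growth0_local_min H; apply/growth0_local_min.
  (* With [c = 0] the transferred constant [min c k / 2] is 0, since [k >= 0]. *)
  have := local_growth_objective_envelope (lexx 0) H.
  rewrite min_l ?mul0r// divr_ge0// subr_ge0 -(ler_pM2l gamma0).
  by rewrite mulfV ?gt_eqF// ltW.
exact: local_growth_envelope_objective.
Qed.

(** Positive definiteness of the envelope Hessian is the hub: strong growth of the envelope is
    equivalent to it, and at a local minimum so is nonsingularity of the Jacobian of [Rg]. *)
Lemma strong_local_min_tfae :
  [<-> strong_local_min (objective f g) xs;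
       local_min (objective f g) xs /\ 'J Rg xs \in unitmx;
       posdef (hessian phi xs);
       strong_local_min (fb_envelope f g gamma) xs;
       local_min (fb_envelope f g gamma) xs /\ 'J Rg xs \in unitmx].
Proof.
have semidef : local_min (fb_envelope f g gamma) xs ->
    forall h, 0 <= dotp h (h *m hessian phi xs).
  move=> /growth0_local_min/local_growth_hessian H h.
  by have := H h; rewrite mulr0 mul0r.
have strong_posdef : strong_local_min (fb_envelope f g gamma) xs ->
    posdef (hessian phi xs).
  move=> [c c0 /local_growth_hessian H]; split=> [|d d0].
    exact: fb_envelope_hessian_sym.
  by apply: lt_le_trans (H d); rewrite !mulr_gt0// dotpp_gt0.
have unit_posdef :
    local_min (fb_envelope f g gamma) xs /\ 'J Rg xs \in unitmx ->
    posdef (hessian phi xs).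
  move=> [/semidef H]; rewrite -unitmx_hessian_residual => Hu.
  by apply: unitmx_posdef => //; exact: fb_envelope_hessian_sym.
have strong_unit : strong_local_min (fb_envelope f g gamma) xs ->
    'J Rg xs \in unitmx.
  move=> /strong_posdef H; rewrite -unitmx_hessian_residual.
  exact: posdef_unitmx.
tfae.
- move=> H; split; first exact: strong_local_minW.
  exact/strong_unit/strong_local_min_objective_envelope.
- by move=> [/local_min_objective_envelope H Ju]; exact: unit_posdef.
- exact: posdef_strong_local_min.
- by move=> H; split; [exact: strong_local_minW|exact: strong_unit].
- move=> H; apply/strong_local_min_objective_envelope/posdef_strong_local_min.
  exact: unit_posdef.
Qed.

End ForwardBackwardEnvelope.

(** The modulus is an infimum below [1 / gamma], so some admissible Lipschitz constant lies below
    [1 / gamma] too. *)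
Lemma lipschitz_modulus_witness {R : realType} {n : nat}
    (F : 'rV[R]_n -> 'rV[R]_n) (gamma : R) :
  lipschitz_const F !=set0 -> 0 < gamma ->
  (gamma%:E < ((lipschitz_modulus F)%:E)^-1)%E ->
  exists L : R, [/\ 0 <= L, gamma * L < 1 &
    forall x y, enorm (F x - F y) <= L * enorm (x - y)].
Proof.
move=> FL gamma0 gF.
have m0 : 0 <= lipschitz_modulus F by apply: lb_le_inf => // L [].
have mg : lipschitz_modulus F < gamma^-1.
  (* A zero modulus has inverse [+oo] and is treated apart: the claim is then [0 < 1 / gamma]. *)
  have [->|mn0] := eqVneq (lipschitz_modulus F) 0; first by rewrite invr_gt0.
  have mp : 0 < lipschitz_modulus F by rewrite lt_neqAle eq_sym mn0.
  move: gF; rewrite inver (negPf mn0) lte_fin => gF.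
  by rewrite -(invrK (lipschitz_modulus F)) ltf_pV2 ?posrE ?invr_gt0.
have [L [L0 FLL] Lg] := inf_lt FL mg.
by exists L; split=> //; rewrite -ltr_pdivlMl// mulr1.
Qed.

Theorem theorem4p11 (R : realType) (n : nat)
    (f : 'rV[R]_n -> R) (g : 'rV[R]_n -> \bar R)
    (xstar : 'rV[R]_n) (gamma : R)
    (f_diff : forall x, differentiable f x)
    (grad_f_lip : lipschitz_const (grad f) !=set0)
    (g_proper : proper_fun g)
    (g_lsc : lower_semicontinuous g)
    (g_prox_bounded : prox_bounded g)
    (argmin_neq0 : argmin (objective f g) !=set0)
    (xstar_critical : critical f g xstar)
    (xstar_A2 : second_order_assumption f g xstar)
    (gamma_gt0 : 0 < gamma)
    (gamma_lt : (gamma%:E < Order.min (critical_threshold f g xstar)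
                              ((lipschitz_modulus (grad f))%:E)^-1)%E)
    (R_single_valued : single_valued_around (fb_residual f g gamma) xstar) :
  let JR := 'J (value_of (fb_residual f g gamma)) xstar in
  let phi_gamma := fb_envelope f g gamma in
  [<-> strong_local_min (objective f g) xstar;
       local_min (objective f g) xstar /\ JR \in unitmx;
       posdef (hessian (fine \o phi_gamma) xstar);
       strong_local_min phi_gamma xstar;
       local_min phi_gamma xstar /\ JR \in unitmx].
Proof.
move=> JR phi_gamma.
move: gamma_lt; rewrite lt_min => /andP[].
(* The supremum provides [gamma' > gamma] for which [xstar] is fixed; the adjoined value 0 is
   excluded by [gamma > 0]. *)
move=> /ereal_sup_gt[_ [gamma' Hg' <-]] + gammaL.
rewrite lte_fin => gamma_lt'; case: Hg' => [[gamma'0 xs_fix]|/= g0]; last first.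
  by move: gamma_gt0; rewrite ltNge -g0 ltW.
have [L [L0 gL f_lip]] := lipschitz_modulus_witness grad_f_lip gamma_gt0 gammaL.
have := fineK (prox_fin_num g_proper xs_fix); move: (fine _) => gx /esym gxE.
have [f_C2 _ [S [M g_epi]]] := xstar_A2.
exact: (strong_local_min_tfae f_diff L0 f_lip g_proper g_lsc gamma_gt0
  gamma_lt' gL gxE xs_fix f_C2 g_epi R_single_valued).
Qed.
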